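(* Let $X$ be a compact metric space with $\dim X=d<\infty$, and suppose that $X$ belongs to the class $0\text{-}\mathcal{DCR}$. Then the following assertions (1)–(3) hold. (1) Let $\alpha>0$ and let $S\subset\mathbb N$ be a set of cardinality $2d+1$. Then the set $E(\alpha;S)$ of all pairs $(T,f)\in C(X,X)\times C(X,\mathbb R)$ such that $I^S_{T,f}:X\to\mathbb R^S$ is an $\alpha$ trajectory-embedding is a dense open subset of $C(X,X)\times C(X,\mathbb R)$. (2) There exists a dense $G_\delta$-set $E$ of $C(X,X)\times C(X,\mathbb R)$ such that if $(T,f)\in E$, then for every $S\subset\mathbb N$ of cardinality $2d+1$ the map $I^S_{T,f}:X\to\mathbb R^S$ is a trajectory-embedding. (3) If $E$ is a set as in (2), then for any $(T,f)\in E$ the infinite delay observation map $I_{T,f}=I^{\mathbb N}_{T,f}:(X,T)\to(\mathbb R^{\mathbb N},\sigma)$ satisfies the following conditions, where $\sigma_{T,f}=\sigma|I_{T,f}(X)$: (a) $I_{T,f}$ induces a bijection $[O(T)]\cong[O(\sigma_{T,f})]$; (b) $h(T)=h(\sigma_{T,f})$; (c) if $x,y\in X$ are trajectory-separated for $T$, then $|\{i\in\mathbb N : I_{T,f}(x)_i=I_{T,f}(y)_i\}|\le 2d$. In particular, $X$ is a reconstruction space of dynamical systems.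
   Context: All spaces are separable metric, all maps are continuous, $\mathbb N=\{0,1,2,\dots\}$, and $\dim$ is the topological (covering) dimension. For a compact metric space $X$ and a space $Y$ with complete metric $d_Y$, $C(X,Y)$ is the space of all maps $X\to Y$ with the sup metric $d(f,g)=\sup_{x\in X}d_Y(f(x),g(x))$; products of such spaces carry the product topology. A map $T:X\to X$ is doubly 0-dimensional if for each closed set $A\subset X$ of dimension $0$ one has $\dim T^{-1}(A)\le 0$ and $\dim T(A)=0$. A point $x\in X$ is a chain recurrent point of $T$ if for every $\epsilon>0$ there is a finite sequence $x=x_0,x_1,\dots,x_m=x$ ($m\ge1$) in $X$ with $d(T(x_i),x_{i+1})<\epsilon$ for $i=0,\dots,m-1$; $CR(T)$ is the set of chain recurrent points. The class $0\text{-}\mathcal{DCR}$ consists of all compact metric spaces $X$ such that: ($0$-$\mathcal D$) the set of doubly 0-dimensional maps $T:X\to X$ is dense in $C(X,X)$; and ($0$-$\mathcal{CR}$) the set of maps $T:X\to X$ with $\dim CR(T)=0$ is dense in $C(X,X)$. For $T\in C(X,X)$, $f\in C(X,\mathbb R)$ and $S\subset\mathbb N$, $I^S_{T,f}:X\to\mathbb R^S$ is $x\mapsto (fT^j(x))_{j\in S}$, and $I_{T,f}:=I^{\mathbb N}_{T,f}$. $I^S_{T,f}$ is a trajectory-embedding if $I^S_{T,f}(x)\ne I^S_{T,f}(y)$ whenever $x,y\in X$ satisfy $T^j(x)\ne T^j(y)$ for all $j\in S$. For $\alpha>0$, $I^S_{T,f}$ is an $\alpha$ trajectory-embedding if $I^S_{T,f}(x)\ne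 I^S_{T,f}(y)$ whenever $x,y\in X$ satisfy $d(T^j(x),T^j(y))\ge\alpha$ for all $j\in S$. Points $x,y$ are trajectory-separated for $T$ if $T^j(x)\neq T^j(y)$ for all $j\in\mathbb N$. $\sigma:\mathbb R^{\mathbb N}\to\mathbb R^{\mathbb N}$ is the one-sided shift $\sigma(x_0,x_1,x_2,\dots)=(x_1,x_2,\dots)$. A dynamical system $(X,T)$ is a space with a map $T:X\to X$; a morphism $h:(X,T)\to(X',T')$ is a map with $hT=T'h$. For $x\in X$, $o_T(x)=(T^i(x))_{i\in\mathbb N}$; $o_T(x)\sim_e o_T(y)$ if there is $n\in\mathbb N$ with $T^i(x)=T^i(y)$ for all $i\ge n$; $[o_T(x)]$ is the equivalence class of $o_T(x)$ and $[O(T)]=\{[o_T(x)]:x\in X\}$. A morphism $h$ induces $[O(T)]\to[O(T')]$, $[o_T(x)]\mapsto[o_{T'}(h(x))]$. $h(T)$ denotes topological entropy. A compact metric space $X$ is a reconstruction space of dynamical systems if there is a dense $G_\delta$-set $E$ of $C(X,X)\times C(X,\mathbb R)$ such that for every $(T,f)\in E$, $I_{T,f}$ induces a bijection $[O(T)]\cong[O(\sigma_{T,f})]$ and $h(T)=h(\sigma_{T,f})$, where $\sigma_{T,f}=\sigma|I_{T,f}(X)$. *)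

(* Defs.v *)
From HB Require Import structures.
From mathcomp Require Import all_boot all_order all_algebra.
From mathcomp Require Import all_classical all_reals all_analysis.
From mathcomp Require Import borel_hierarchy.
Set Implicit Arguments.
Unset Strict Implicit.
Unset Printing Implicit Defensive.
Import Order.TTheory GRing.Theory Num.Theory.
Import numFieldNormedType.Exports.
(* Gives [continuousType X Y] the topology of uniform convergence, i.e. the
   one induced by the sup metric when X is compact and Y is metric. *)
Import ArrowAsUniformType.
Local Open Scope classical_set_scope.
Local Open Scope card_scope.
Local Open Scope ring_scope.

Section covering_dimension.
Variable X : topologicalType.

(* dim X < n: every finite open cover has a finite open refinement such that
   each point lies in at most n of its members.  Bounding dim by n strictly,
   with n natural, covers the value dim X = -1 of the empty space. *)
Definition dim_lt (n : nat) : Prop :=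
  forall (k : nat) (U : 'I_k -> set X),
    (forall i, open (U i)) -> \bigcup_i U i = setT ->
    exists (m : nat) (V : 'I_m -> set X),
      [/\ forall j, open (V j),
          \bigcup_j V j = setT,
          forall j, exists i, V j `<=` U i &
          forall x, (#|[set j | `[< V j x >]]%SET| <= n)%N].

Definition dim_le (n : nat) : Prop := dim_lt n.+1.

Definition dim_eq (n : nat) : Prop := dim_le n /\ ~ dim_lt n.

End covering_dimension.

Section maps_of_metric_spaces.
Variables (R : realType) (X : metricType R).

Definition doubly_zero_dim (T : X -> X) : Prop :=
  forall A : set X, closed A -> dim_eq (set_type A) 0 ->
    dim_le (set_type (T @^-1` A)) 0 /\ dim_eq (set_type (T @` A)) 0.

Definition chain_recurrent (T : X -> X) : set X :=
  [set p | forall e : R, 0 < e ->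
     exists (m : nat) (x : nat -> X),
       [/\ (0 < m)%N, x 0%N = p, x m = p &
           forall i, (i < m)%N -> mdist (T (x i)) (x i.+1) < e]].

Definition zero_DCR : Prop :=
  [/\ compact [set: X],
      dense [set T : continuousType X X | doubly_zero_dim T] &
      dense [set T : continuousType X X |
               dim_eq (set_type (chain_recurrent T)) 0]].

End maps_of_metric_spaces.

Section trajectories.
Variables (Z : Type) (g : Z -> Z).

Definition trajectory (z : Z) : nat -> Z := fun i => iter i g z.

Definition tail_equiv (u v : nat -> Z) : Prop :=
  exists n : nat, forall i, (n <= i)%N -> u i = v i.

Definition trajectory_class (z : Z) : set (nat -> Z) :=
  [set o | range trajectory o /\ tail_equiv (trajectory z) o].

Definition trajectory_classes : set (set (nat -> Z)) := range trajectory_class.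

Definition trajectory_separated (x y : Z) : Prop :=
  forall j : nat, iter j g x <> iter j g y.

End trajectories.

(* The existence of F includes that the map induced by h on the classes is
   well defined. *)
Definition induces_bijection (Z Z' : Type) (g : Z -> Z) (g' : Z' -> Z')
    (h : Z -> Z') : Prop :=
  exists F : set (nat -> Z) -> set (nat -> Z'),
    (forall z, F (trajectory_class g z) = trajectory_class g' (h z)) /\
    set_bij (trajectory_classes g) (trajectory_classes g') F.

(* Topological entropy of a self-map of a compact space, defined by open
   covers (Adler, Konheim and McAndrew). *)
Section entropy.
Variables (R : realType) (Z : topologicalType).

Definition open_cover (U : set (set Z)) : Prop :=
  (forall u, U u -> open u) /\ \bigcup_(u in U) u = setT.

(* This infimum is a minimum when Z is compact and U is an open cover. *)
Definition subcover_number (U : set (set Z)) : R :=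
  inf [set k%:R | k in [set k : nat | exists W : set (set Z),
        [/\ W `<=` U, W #= `I_k & \bigcup_(w in W) w = setT]]].

Definition cover_join (U V : set (set Z)) : set (set Z) :=
  [set w | exists u v, [/\ U u, V v & w = u `&` v]].

Definition cover_preimage (g : Z -> Z) (U : set (set Z)) : set (set Z) :=
  [set g @^-1` u | u in U].

(* The join of the covers g^{-i}(U) for i < n. *)
Fixpoint iterated_cover (g : Z -> Z) (U : set (set Z)) (n : nat) :
    set (set Z) :=
  if n is n'.+1
  then cover_join (iterated_cover g U n') (cover_preimage (iter n' g) U)
  else [set setT].

(* For g continuous on a compact Z the limit exists, by subadditivity. *)
Definition cover_entropy (g : Z -> Z) (U : set (set Z)) : R :=
  limn (fun n : nat => ln (subcover_number (iterated_cover g U n)) / n%:R).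

Definition entropy (g : Z -> Z) : \bar R :=
  ereal_sup [set (cover_entropy g U)%:E | U in open_cover].

End entropy.

Section delay_observation.
Variables (R : realType) (X : metricType R).
Implicit Types (T : X -> X) (f : X -> R) (S : set nat).

(* {ptws nat -> R} is R^N with the product topology. *)
Definition shift (z : {ptws nat -> R}) : {ptws nat -> R} := fun i => z i.+1.

Definition delay_map T f (x : X) : {ptws nat -> R} := fun j => f (iter j T x).

Definition delay_map_on S T f (x : X) : set_type S -> R :=
  fun j => f (iter (\val j) T x).

Definition trajectory_embedding S T f : Prop :=
  forall x y : X, (forall j, S j -> iter j T x <> iter j T y) ->
    delay_map_on (S := S) T f x <> delay_map_on T f y.

Definition alpha_trajectory_embedding (alpha : R) S T f : Prop :=
  forall x y : X, (forall j, S j -> alpha <= mdist (iter j T x) (iter j T y)) ->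
    delay_map_on (S := S) T f x <> delay_map_on T f y.

Lemma shift_delay_map T f x : shift (delay_map T f x) = delay_map T f (T x).
Proof. by apply/funext => j; rewrite /shift /delay_map iterSr. Qed.

Lemma shift_range T f (z : set_type (range (delay_map T f))) :
  shift (\val z) \in range (delay_map T f).
Proof.
case: z => z /= /set_mem[x _ <-]; apply/mem_set.
by exists (T x) => //; rewrite shift_delay_map.
Qed.

Lemma delay_map_range T f x : delay_map T f x \in range (delay_map T f).
Proof. by apply/mem_set; exists x. Qed.

Definition shift_on_range T f (z : set_type (range (delay_map T f))) :
  set_type (range (delay_map T f)) := exist _ (shift (\val z)) (shift_range z).

Definition delay_onto_range T f (x : X) : set_type (range (delay_map T f)) :=
  exist _ (delay_map T f x) (delay_map_range T f x).

Definition induces_trajectory_bijection T f : Prop :=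
  induces_bijection T (@shift_on_range T f) (delay_onto_range T f).

Definition preserves_entropy T f : Prop :=
  entropy R T = entropy R (@shift_on_range T f).

Definition reconstruction_space : Prop :=
  compact [set: X] /\
  exists E : set (continuousType X X * continuousType X R),
    [/\ Gdelta E, dense E &
        forall (T : continuousType X X) (f : continuousType X R), E (T, f) ->
          induces_trajectory_bijection T f /\ preserves_entropy T f].

(* The dense G_delta-sets of pairs (T, f) whose delay maps on every index set
   of cardinality 2d+1 are trajectory-embeddings. *)
Definition generic_embedding_set (d : nat)
    (E : set (continuousType X X * continuousType X R)) : Prop :=
  [/\ Gdelta E, dense E &
      forall (T : continuousType X X) (f : continuousType X R), E (T, f) ->
        forall S : set nat, S #= `I_(2 * d + 1) -> trajectory_embedding S T f].

End delay_observation.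

(* Main.v *)
(* Parts (2) and (3) follow from (1): (2) by the Baire property of
   C(X,X) x C(X,R), and (3) because equality of two delay sequences forces
   T^{2d}x = T^{2d}y, so that T^{2d} factors continuously through the delay map.

   For the density in (1), let m bound S.  By 0-DCR, perturb T so that it maps
   zero-dimensional closed sets to such sets and so that its points of period at
   most m lie in a finite disjoint union of small open sets; cover the rest of X
   by small open sets U_i disjoint from their first m iterates.  Inside each U_i
   choose in turn a closed separator, avoiding the T^j-images of countably many
   zero-dimensional sets picked so that meeting one more separator lowers the
   dimension by one.  Then no orbit segment x, ..., T^m x meets the separators
   more than d times, and off a neighbourhood of them X splits into
   finitely many small clopen pieces.  An observable f taking distinct constant
   values on the pieces separates x and y at some j in S: each of the two orbits
   leaves the pieces at most d times, and S has 2d+1 elements. *)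

Require Import Defs.
From HB Require Import structures.
From mathcomp Require Import all_boot all_order all_algebra.
From mathcomp Require Import all_classical all_reals all_analysis.
From mathcomp Require Import borel_hierarchy.
From mathcomp Require Import zify lra.
Set Implicit Arguments.
Unset Strict Implicit.
Unset Printing Implicit Defensive.
Import Order.TTheory GRing.Theory Num.Theory.
Import numFieldNormedType.Exports.
Import ArrowAsUniformType.
Local Open Scope classical_set_scope.
Local Open Scope card_scope.
Local Open Scope ring_scope.

(** In the dynamical argument the dimension of X enters only through [rdim]. What is needed is a
    notion that passes to subsets and to finite unions of closed sets, and that drops by one when a
    closed set avoids countably many prescribed zero-dimensional sets. It comes from covering
    dimension through a sequence of separators, at most d of them through any point.

    Periodic points are the obstacle to choosing the U_i: no neighbourhood of a point of period at
    most m is disjoint from all of its first m iterates.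

    The two sets of maps in 0-DCR are only known to be dense, so the map is perturbed twice: once to
    make CR(T) zero-dimensional, which fixes the open sets around the periodic points, and once more
    to make T doubly 0-dimensional. The second perturbation does no harm because having all points
    of period at most m inside a given open set is an open condition on T, whereas no such stability
    is known for the dimension of CR(T). *)

Lemma compact_finite_subcover (T : topologicalType) (A : set T)
    (f : T -> set T) :
  compact A -> (forall x, A x -> nbhs x (f x)) ->
  exists2 s : seq T, (forall y, y \in s -> A y) &
    forall x, A x -> exists2 y, y \in s & f y x.
Proof.
move=> /compact_near_coveringP cA Af.
(* Finite lists directed by inclusion: a near covering along this filter yields one list that serves
   all points of A at once. *)
pose F := filter_from [set: seq T] (fun s0 =>
    [set s : seq T | forall y, y \in s0 -> y \in s]).
have FF : Filter F.
  apply: filter_from_filter; first by exists [::].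
  move=> s1 s2 _ _; exists (s1 ++ s2) => // s /= sub.
  by split=> y ys; apply: sub; rewrite mem_cat ys ?orbT.
have [x Ax|s0 _ s0P] :=
    cA _ F (fun s x => exists2 y, y \in s & A y /\ f y x) FF.
  exists (f x, [set s | x \in s]); first split => /=; first exact: Af.
    by exists [:: x] => // s /(_ x); rewrite mem_head; apply.
  by move=> [x' s] /= [fx xs]; exists x.
exists [seq y <- s0 | `[< A y >]].
  by move=> y; rewrite mem_filter => /andP[/asboolP].
move=> x /(s0P s0 (fun _ => id))[y ys0 [Ay fyx]].
by exists y => //; rewrite mem_filter ys0 andbT; apply/asboolP.
Qed.

Lemma continuous_iter (X : topologicalType) (g : X -> X) j :
  continuous g -> continuous (iter j g).
Proof.
move=> cg; elim: j => [|j IH] x /=; first exact: cvg_id.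
by apply: continuous_comp; [exact: IH|exact: cg].
Qed.

(** * Function spaces and the Baire property *)

Section uniform_function_space.
Context {R : realType}.

Lemma nbhs_continuousTypeP (X : topologicalType) (Y : pseudoMetricType R)
    (g : continuousType X Y) (A : set (continuousType X Y)) :
  nbhs g A <-> exists2 e : R, 0 < e &
    forall g' : continuousType X Y, (forall x, ball (g x) e (g' x)) -> A g'.
Proof.
split.
  move=> [B [[C oC CB] Bg BA]].
  have : nbhs (g : X -> Y) C by apply: open_nbhs_nbhs; split => //;
      rewrite -CB in Bg.
  rewrite -nbhs_entourageE => -[E [W entW WE] EC].
  move: entW; rewrite -entourage_ballE => -[e /= e0 eW].
  exists e => // g' gg'; apply: BA; rewrite -CB /=; apply: EC.
  apply/xsectionP; apply: WE => x; apply: eW; exact: gg'.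
move=> [e e0 eA].
have ng : nbhs (g : X -> Y) [set h : X -> Y | forall x, ball (g x) e (h x)].
  rewrite -nbhs_entourageE.
  exists [set p : (X -> Y) * (X -> Y) | forall x, ball (p.1 x) e (p.2 x)].
    by exists [set p | ball p.1 e p.2];
        first exact: (entourage_ball _ (PosNum e0)).
  by move=> h /xsectionP.
have ic : {for g, continuous (id : continuousType X Y -> (X -> Y))}.
  exact: initial_continuous.
have := ic _ ng; rewrite nbhs_simpl /=; apply: filterS => g'; exact: eA.
Qed.

Lemma evaluation_continuous (X : topologicalType) (Y : pseudoMetricType R) :
  continuous (fun p : continuousType X Y * X => p.1 p.2).
Proof.
move=> [g x] /=; apply/cvg_ballP => e e0.
have e2 : 0 < e / 2 by rewrite divr_gt0.
have gx : nbhs x [set y | ball (g x) (e / 2) (g y)].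
  by have /cvg_ballP := @cts_fun _ _ g x; apply.
exists ([set h : continuousType X Y | forall y, ball (g y) (e / 2) (h y)],
        [set y | ball (g x) (e / 2) (g y)]).
  by split => //=; apply/nbhs_continuousTypeP; exists (e / 2).
move=> [h y] /= [gh xy]; rewrite [e]splitr; exact: ball_triangle (gh y).
Qed.

Lemma iterate_continuous (X : pseudoMetricType R) (j : nat) :
  continuous (fun p : continuousType X X * X => iter j p.1 p.2).
Proof.
elim: j => [|j IH] /=; first by move=> p; exact: cvg_snd.
move=> p; apply: (@continuous_comp _ _ _
  (fun p : continuousType X X * X => (p.1, iter j p.1 p.2))
  (fun q : continuousType X X * X => q.1 q.2));
  last exact: evaluation_continuous.
exact: (cvg_pair cvg_fst (IH p)).
Qed.

Lemma observation_continuous (X : pseudoMetricType R) (j : nat) :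
  continuous (fun p : continuousType X X * continuousType X R * X =>
                p.1.2 (iter j p.1.1 p.2)).
Proof.
move=> p; apply: (@continuous_comp _ _ _
  (fun p : continuousType X X * continuousType X R * X =>
    (p.1.2, iter j p.1.1 p.2))
  (fun q : continuousType X R * X => q.1 q.2));
  last exact: evaluation_continuous.
have c12 : {for p, continuous (fun p : continuousType X X *
    continuousType X R * X => p.1.2)}.
  exact: (@cvg_comp _ _ _ fst snd _ _ _ cvg_fst cvg_snd).
have c11 : {for p, continuous (fun p : continuousType X X *
    continuousType X R * X => p.1.1)}.
  exact: (@cvg_comp _ _ _ fst fst _ _ _ cvg_fst cvg_fst).
apply: (cvg_pair c12).
apply: (@continuous_comp _ _ _
  (fun p : continuousType X X * continuousType X R * X => (p.1.1, p.2))
  (fun q : continuousType X X * X => iter j q.1 q.2));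
  last exact: iterate_continuous.
exact: (cvg_pair c11 cvg_snd).
Qed.

End uniform_function_space.

Section alpha_embeddings_open.
Context {R : realType} {X : metricType R}.
Local Notation pairs := (continuousType X X * continuousType X R)%type.

Lemma iterate_near (j : nat) (p : pairs) (x : X) (e : R) : 0 < e ->
  exists U V, [/\ nbhs p U, nbhs x V & forall q y, U q -> V y ->
    ball (iter j p.1 x) e (iter j q.1 y)].
Proof.
move=> e0; have /cvg_ballP/(_ e e0) := @iterate_continuous R X j (p.1, x).
move=> [[U V] /= [nU nV] UV]; exists (U `*` setT), V; split => //.
  by exists (U, setT) => //=; split => //; exact: filterT.
by move=> q y [Uq _] Vy; exact: (UV (q.1, y)).
Qed.

Lemma observation_near (j : nat) (p : pairs) (x : X) (e : R) : 0 < e ->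
  exists U V, [/\ nbhs p U, nbhs x V & forall q y, U q -> V y ->
    ball (p.2 (iter j p.1 x)) e (q.2 (iter j q.1 y))].
Proof.
move=> e0; have /cvg_ballP/(_ e e0) := @observation_continuous R X j (p, x).
move=> [[U V] /= [nU nV] UV]; exists U, V; split => //.
by move=> q y Uq Vy; exact: (UV (q, y)).
Qed.

(** Stated positively, every pair (x, y) has some j in S with a distance below alpha or with two
    different observations. Either condition survives small changes of T, f, x and y, and
    compactness of X x X makes the neighbourhood of (T, f) independent of (x, y). *)
Lemma alpha_trajectory_embedding_open (alpha : R) (S : set nat) :
  compact [set: X] ->
  open [set p : pairs | alpha_trajectory_embedding alpha S p.1 p.2].
Proof.
move=> cX; rewrite openE => p /= pE; rewrite /interior.
pose Q (q : pairs) (z : X * X) := exists2 j, S j &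
  (mdist (iter j q.1 z.1) (iter j q.1 z.2) < alpha) ||
  (q.2 (iter j q.1 z.1) != q.2 (iter j q.1 z.2)).
have cXX : compact [set: X * X] by rewrite -setXTT; exact: compact_setX.
have Qnear : \forall q \near p, [set: X * X] `<=` Q q.
  have cov : near_covering [set: X * X] by exact/compact_near_coveringP.
  apply: (cov _ (nbhs p) Q) => -[x y] _.
  suff [j Sj [U [V [W [nU nV nW UVW]]]]] : exists2 j, S j &
      exists U V W, [/\ nbhs p U, nbhs x V, nbhs y W &
      forall q x' y', U q -> V x' -> W y' ->
      (mdist (iter j q.1 x') (iter j q.1 y') < alpha) ||
      (q.2 (iter j q.1 x') != q.2 (iter j q.1 y'))].
    exists (V `*` W, U); first by split => //; exists (V, W).
    by move=> [[x' y'] q] /= [[Vx Wy] Uq]; exists j => //; exact: UVW.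
  have : Q p (x, y).
    apply: contrapT => nQ; apply: (pE x y).
      move=> j Sj; rewrite leNgt; apply/negP => lt; apply: nQ.
      by exists j => //; rewrite lt.
    apply/funext => -[j /= Sj]; apply: contrapT => /eqP ne; apply: nQ.
    by exists j; [exact/set_mem|rewrite ne orbT].
  move=> [j Sj /= /orP[lt|ne]]; exists j => //.
    pose e := (alpha - mdist (iter j p.1 x) (iter j p.1 y)) / 2.
    have e0 : 0 < e by rewrite divr_gt0 // subr_gt0.
    have [U1 [V [nU1 nV UV]]] := iterate_near j p x e0.
    have [U2 [W [nU2 nW UW]]] := iterate_near j p y e0.
    exists (U1 `&` U2), V, W; split => //; first exact: filterI.
    move=> q x' y' [U1q U2q] Vx' Wy'; apply/orP; left.
    have := UV _ _ U1q Vx'; have := UW _ _ U2q Wy'.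
    rewrite !ballEmdist /= => h1 h2.
    have t1 := metric_triangle (iter j q.1 x') (iter j p.1 x) (iter j q.1 y').
    have t2 := metric_triangle (iter j p.1 x) (iter j p.1 y) (iter j q.1 y').
    have ee : alpha = mdist (iter j p.1 x) (iter j p.1 y) + e + e.
      by rewrite -addrA -splitr addrC subrK.
    by rewrite (metric_sym (iter j q.1 x') (iter j p.1 x)) in t1; lra.
  pose e := `|p.2 (iter j p.1 x) - p.2 (iter j p.1 y)| / 2.
  have e0 : 0 < e by rewrite divr_gt0 // normr_gt0 subr_eq0.
  have [U1 [V [nU1 nV UV]]] := observation_near j p x e0.
  have [U2 [W [nU2 nW UW]]] := observation_near j p y e0.
  exists (U1 `&` U2), V, W; split => //; first exact: filterI.
  move=> q x' y' [U1q U2q] Vx' Wy'; apply/orP; right.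
  have h1 := UV _ _ U1q Vx'; have := UW _ _ U2q Wy'.
  apply: contraPneq => <- /ball_sym h2.
  have := ball_triangle h1 h2; rewrite -splitr -ball_normE /= ltxx.
  by [].
apply: filterS Qnear => q Qq x y xy.
have [j Sj /= /orP[|/eqP ne]] := Qq (x, y) I; first by rewrite ltNge xy.
move=> /(congr1 (fun h => h (exist _ j (mem_set Sj)))); exact: ne.
Qed.

End alpha_embeddings_open.

(** Compactness of the sets [K x] supplies the limit values as cluster points: for maps into X the
    whole space is used, for observables a closed interval. A cluster point is only in the closure
    of the ball of radius [e n], hence the doubled radius. *)
Lemma uniform_limit_continuous {R : realType} (X : topologicalType)
    (Y : pseudoMetricType R) (u : nat -> continuousType X Y) (e : nat -> R)
    (K : X -> set Y) :
  (forall n, 0 < e n) -> (forall r : R, 0 < r -> exists n, e n < r) ->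
  (forall n m x, (n <= m)%N -> ball (u n x) (e n) (u m x)) ->
  (forall x, compact (K x)) -> (forall n x, K x (u n x)) ->
  exists g : continuousType X Y, forall n x, ball (u n x) (e n + e n) (g x).
Proof.
move=> e0 e_small ue cK uK.
have lim x : exists y, forall n, ball (u n x) (e n + e n) y.
  have [y [_ yc]] : K x `&` cluster (u ^~ x @ \oo) !=set0.
    by apply: cK; exists 0%N => // n _; exact: uK.
  exists y => n.
  have un : (u ^~ x @ \oo) [set z | ball (u n x) (e n) z].
    by exists n => // m /= nm; exact: ue.
  have [z [uz yz]] := yc _ _ un (nbhsx_ballx y _ (e0 n)).
  exact: ball_triangle uz (ball_sym yz).
have [g gP] := choice lim.
suff gc : continuous g by exists (mkcts gc).
move=> x; apply/cvg_ballP => r r0.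
(* The path from [g x] to [g y] through [u n x] and [u n y] costs five times [e n]: twice at each
   end and once in the middle. *)
have [n nr] := e_small (r / 5) (divr_gt0 r0 (ltr0Sn _ _)).
have /cvg_ballP/(_ _ (e0 n)) := @cts_fun _ _ (u n) x.
apply: filterS => y xy; apply: (@le_ball _ _ _ ((e n + e n) + e n + (e n + e
    n))).
  by lra.
apply: (@ball_triangle _ _ (u n y)); last exact: gP.
apply: (@ball_triangle _ _ (u n x)); last exact: xy.
exact: ball_sym.
Qed.

Section baire_property_of_pairs.
Context {R : realType} {X : metricType R}.
Local Notation pairs := (continuousType X X * continuousType X R)%type.

Definition pair_ball (p : pairs) (e : R) : set pairs :=
  [set q : pairs | (forall x, ball (p.1 x) e (q.1 x)) /\
           (forall x, ball (p.2 x) e (q.2 x))].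

Lemma nbhs_pairP (p : pairs) (A : set pairs) :
  nbhs p A <-> exists2 e : R, 0 < e & pair_ball p e `<=` A.
Proof.
split.
  move=> [[U V] /= [nU nV] UV].
  have [e1 e10 eU] := proj1 (nbhs_continuousTypeP _ _) nU.
  have [e2 e20 eV] := proj1 (nbhs_continuousTypeP _ _) nV.
  exists (Num.min e1 e2); first by rewrite lt_min e10.
  move=> q [h1 h2]; apply: UV; split => /=.
    by apply: eU => x; apply: le_ball (h1 x); rewrite ge_min lexx.
  by apply: eV => x; apply: le_ball (h2 x); rewrite ge_min lexx orbT.
move=> [e e0 eA].
exists ([set g : continuousType X X | forall x, ball (p.1 x) e (g x)],
        [set g : continuousType X R | forall x, ball (p.2 x) e (g x)]).
  by split => /=; apply/nbhs_continuousTypeP; exists e.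
by move=> q [h1 h2]; apply: eA.
Qed.

Lemma pair_ball_center p e : 0 < e -> pair_ball p e p.
Proof. by move=> e0; split => x; exact: ballxx. Qed.

Lemma pair_ball_le p e e' : e <= e' -> pair_ball p e `<=` pair_ball p e'.
Proof. by move=> ee' q [h1 h2]; split => x; apply: le_ball ee' _ _. Qed.

(** The Baire argument with nested balls, where completeness is supplied by
    [uniform_limit_continuous]. *)
Lemma dense_bigcap_open (E : nat -> set pairs) : compact [set: X] ->
  (forall n, open (E n)) -> (forall n, dense (E n)) ->
  dense (\bigcap_n E n).
Proof.
move=> cX oE dE O [p Op] oO.
have [e0 e00 eO] := proj1 (nbhs_pairP _ _) (open_nbhs_nbhs (conj oO Op)).
(* A state is a stage, a centre and a radius. The limit will be known only within twice the radius,
   so the tripled ball is kept inside the previous one. The premise [0 < s.2] makes the relation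
   total, as dependent choice requires. *)
pose step (s s' : nat * pairs * R) := s'.1.1 = s.1.1.+1 /\ (0 < s.2 ->
  [/\ 0 < s'.2, s'.2 <= s.1.1.+1%:R^-1 &
      pair_ball s'.1.2 (3 * s'.2) `<=` E s.1.1 `&` pair_ball s.1.2 s.2]).
have stepE (s : nat * pairs * R) : {s' | step s s'}.
  apply: cid; case: s => -[n q] e; rewrite /step /=.
  have [epos|eneg] := ltP 0 e; last by exists (n.+1, q, e).
  have [q' [iq' Eq']] : (interior (pair_ball q e) `&` E n) !=set0.
    apply: dE; last exact: open_interior.
    by exists q; apply/nbhs_pairP; exists e.
  have : nbhs q' (E n `&` pair_ball q e).
    apply: filterI; last exact: iq'.
    by apply: open_nbhs_nbhs.
  move=> /nbhs_pairP[r r0 rE].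
  exists (n.+1, q', Num.min (r / 3) n.+1%:R^-1); split => // _ /=; split.
  - by rewrite lt_min divr_gt0 //= invr_gt0.
  - by rewrite ge_min lexx orbT.
  - apply: subset_trans rE; apply: pair_ball_le.
    have : Num.min (r / 3) n.+1%:R^-1 <= r / 3 by rewrite ge_min lexx.
    by lra.
have [s [s0 sS]] := dependent_choice stepE (0%N, p, e0 / 3).
have sn n : (s n).1.1 = n.
  by elim: n => [|n IH]; [rewrite s0|have [-> _] := sS n; rewrite IH].
have spos n : 0 < (s n).2.
  elim: n => [|n IH]; first by rewrite s0 divr_gt0.
  by have [_ /(_ IH)[]] := sS n.
pose q n := (s n).1.2; pose e n := (s n).2.
have qS n : pair_ball (q n.+1) (3 * e n.+1) `<=` E n `&` pair_ball (q n) (e n).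
  by have [_ /(_ (spos n))[_ _]] := sS n; rewrite sn.
have qm n k : pair_ball (q (k + n)%N) (e (k + n)%N) `<=` pair_ball (q n) (e n).
  elim: k => [|k IH] //; apply: subset_trans IH => r rb; rewrite addSn in rb.
  apply: (proj2 (qS _ r _)); apply: pair_ball_le rb.
  by have := spos (k + n).+1; rewrite -/(e _); lra.
have qnm n m : (n <= m)%N -> pair_ball (q n) (e n) (q m).
  by move=> /subnK <-; apply: qm; apply: pair_ball_center; exact: spos.
have e_small r : 0 < r -> exists n, e n < r.
  move=> r0; have [N _ NP] := near_infty_natSinv_lt (PosNum r0).
  exists N.+1; apply: le_lt_trans (NP N _); last by rewrite /=.
  by have [_ /(_ (spos N))[_]] := sS N; rewrite sn.
have [T TP] : exists g : continuousType X X,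
    forall n x, ball ((q n).1 x) (e n + e n) (g x).
  apply: (uniform_limit_continuous (K := fun=> setT)) => // n m x nm.
  by have [] := qnm _ _ nm.
have [f fP] : exists g : continuousType X R,
    forall n x, ball ((q n).2 x) (e n + e n) (g x).
  pose K x := `[(q 0%N).2 x - e 0%N, (q 0%N).2 x + e 0%N]%classic.
  apply: (uniform_limit_continuous (K := K)) => //.
  - by move=> n m x nm; have [_] := qnm _ _ nm.
  - by move=> x; exact: segment_compact.
  - move=> n x; have [_ /(_ x)] := qnm 0%N n (leq0n n).
    rewrite -ball_normE /= /K /= in_itv /= => h.
    by move: h; rewrite ltr_norml => /andP[h1 h2]; apply/andP; split; lra.
have lim n : pair_ball (q n) (3 * e n) (T, f).
  apply: (@pair_ball_le _ (e n + e n)); last by split => x;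
      [exact: TP|exact: fP].
  by have := spos n; rewrite -/(e _); lra.
exists (T, f); split; last by move=> n _; exact: (proj1 (qS n _ (lim n.+1))).
apply: eO; have := lim 0%N; rewrite /q /e s0 /=; apply: pair_ball_le; lra.
Qed.

End baire_property_of_pairs.

(** * Delay maps *)

(** Serves to extract exactly 2d+1 indices from a possibly infinite set of coincidences. *)
Lemma card_le_or_subset (T : Type) (A : set T) (n : nat) :
  A #<= `I_n \/ exists2 B, B `<=` A & B #= `I_n.+1.
Proof.
elim: n => [|n [IH|[B BA Bn]]].
- have [->|/set0P[a Aa]] := eqVneq A set0; first by left; exact: card_ge0.
  by right; exists [set a]; [move=> _ ->|exact: card_set1].
- by left; apply: card_le_trans IH _; rewrite card_le_II.
- have [AB|/existsNP[x /not_implyP[Ax nBx]]] := pselect (A `<=` B).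
    by left; apply: card_le_trans (subset_card_le AB) _; by have := Bn;
        rewrite card_eq_le => /andP[].
  right; exists (B `|` [set x]); first by move=> y [/BA|->].
  apply/eq_cardSP; exists x; first by right.
  suff -> : (B `|` [set x]) `\` [set x] = B by [].
  apply/seteqP; split=> y; first by move=> [[]].
  by move=> By; split; [left|move=> yx; apply: nBx; rewrite -yx].
Qed.

Section trajectory_embeddings.
Context {R : realType} {X : metricType R}.
Local Notation pairs := (continuousType X X * continuousType X R)%type.

Lemma separation_constant (s : seq nat) (u v : nat -> X) :
  (forall j, j \in s -> u j <> v j) ->
  exists k : nat, forall j, j \in s -> k.+1%:R^-1 <= mdist (u j) (v j).
Proof.
elim: s => [|i s IH] uv; first by exists 0%N.
have [|k kP] := IH; first by move=> j js; apply: uv; rewrite inE js orbT.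
have ui : 0 < mdist (u i) (v i).
  by rewrite mdist_gt0; apply/eqP; apply: uv; rewrite mem_head.
have [N _ NP] := near_infty_natSinv_lt (PosNum ui).
exists (maxn k N) => j; rewrite inE => /orP[/eqP->|js].
  by apply/ltW/NP => /=; exact: leq_maxr.
apply: le_trans (kP _ js); rewrite lef_pV2 ?posrE ?ltr0n // ler_nat ltnS.
exact: leq_maxl.
Qed.

Lemma trajectory_embedding_alpha (S : set nat) T f : finite_set S ->
  (forall k : nat, alpha_trajectory_embedding k.+1%:R^-1 S T f) ->
  @trajectory_embedding R X S T f.
Proof.
move=> /finite_seqP[s ->] aE x y xy.
have [k kP] := @separation_constant s (fun j => iter j T x)
  (fun j => iter j T y) xy.
exact: aE kP.
Qed.

(** Countably many open conditions suffice: index sets of size 2d+1 are coded by lists, and alpha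
    may run through the numbers 1/(k+1), because finitely many positive distances have a positive
    lower bound. Codes of no admissible index set contribute the whole space. *)
Lemma exists_generic_embedding_set (d : nat) : compact [set: X] ->
  (forall (alpha : R) (S : set nat), 0 < alpha -> S #= `I_(2 * d + 1) ->
     dense [set p : pairs | alpha_trajectory_embedding alpha S p.1 p.2]) ->
  exists E : set pairs, generic_embedding_set d E.
Proof.
move=> cX dE.
pose A n : set pairs :=
  if unpickle n is Some (s, k) then
    if `[< [set` (s : seq nat)] #= `I_(2 * d + 1) >] then
      [set p : pairs |
         alpha_trajectory_embedding (k : nat).+1%:R^-1 [set` s] p.1 p.2]
    else setT
  else setT.
have oA n : open (A n).
  rewrite /A; case: unpickle => [[s k]|]; last exact: openT.
  case: ifP => _; last exact: openT.
  exact: alpha_trajectory_embedding_open.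
have dA n : dense (A n).
  have dT : dense [set: pairs] by move=> O [p Op] _; exists p.
  rewrite /A; case: unpickle => [[s k]|] //.
  by case: asboolP => // sd; apply: dE; rewrite ?invr_gt0.
exists (\bigcap_n A n); split; first by exists A.
  exact: dense_bigcap_open.
move=> T f TfA S Sd.
have fS : finite_set S by apply/finite_setP; exists (2 * d + 1)%N.
apply: trajectory_embedding_alpha => // k.
have [s sE] := proj1 (finite_seqP _) fS.
have := TfA (pickle (s, k)) I; rewrite /A pickleK -sE.
by case: asboolP.
Qed.

Section reconstruction.
Variables (d : nat) (T : continuousType X X) (f : continuousType X R).
Hypothesis TfE : forall S : set nat, S #= `I_(2 * d + 1) ->
  trajectory_embedding S T f.

Lemma card_coincidences_le (x y : X) : trajectory_separated T x y ->
  [set i : nat | delay_map T f x i = delay_map T f y i] #<= `I_(2 * d).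
Proof.
move=> xy; set A := [set i | _].
have [//|[B BA Bd]] := card_le_or_subset A (2 * d).
exfalso; rewrite -addn1 in Bd.
apply: (TfE Bd (x := x) (y := y)) => [j _|]; first exact: xy.
by apply/funext => j; exact: (BA _ (set_mem (valP j))).
Qed.

(** Take S = {0, ..., 2d}: if the orbits agreed at some time of S, they would agree from then on, in
    particular at time 2d. *)
Lemma delay_map_eq_iter (x y : X) :
  delay_map T f x = delay_map T f y -> iter (2 * d) T x = iter (2 * d) T y.
Proof.
move=> xy; apply: contrapT => ne.
apply: (TfE (card_eqxx _) (x := x) (y := y)).
  move=> j /=; rewrite addn1 ltnS => jd eqj; apply: ne.
  by rewrite -(subnK jd) !iterD eqj.
by apply/funext => j; rewrite /delay_map_on; have := congr1 (@^~ (\val j)) xy.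
Qed.

Lemma iter_shift_on_range (i : nat) (x : X) :
  iter i (@shift_on_range R X T f) (delay_onto_range T f x) =
  delay_onto_range T f (iter i T x).
Proof.
elim: i => //= i ->; apply/val_inj; exact: shift_delay_map.
Qed.

Lemma delay_induces_bijection : induces_trajectory_bijection T f.
Proof.
set h := delay_onto_range T f.
pose sg := @shift_on_range R X T f.
have cls (Z : Type) (g : Z -> Z) z w :
    trajectory_class g z = trajectory_class g w <->
    tail_equiv (trajectory g z) (trajectory g w).
  split=> [zw|[n zw]].
    have : trajectory_class g w (trajectory g w).
      by split; [exists w|exists 0%N].
    by rewrite -zw => -[].
  apply/seteqP; split=> o [ro [m mo]]; split => //; exists (maxn n m) => i;
    rewrite geq_max => /andP[ni mi].
    by rewrite -zw // mo.
  by rewrite zw // mo.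
(* The union of the image classes over all points x representing c; [FE] shows that they
   coincide. *)
exists (fun c => [set o | exists x, c = trajectory_class T x /\
                                    trajectory_class sg (h x) o]).
have hT x y : trajectory_class T x = trajectory_class T y ->
    trajectory_class sg (h x) = trajectory_class sg (h y).
  move=> /cls[n xy]; apply/cls; exists n => i ni.
  rewrite /trajectory !iter_shift_on_range; congr delay_onto_range.
  exact: xy.
have FE x : [set o | exists x', trajectory_class T x = trajectory_class T x' /\
    trajectory_class sg (h x') o] = trajectory_class sg (h x).
  apply/seteqP; split=> u; last by move=> xu; exists x.
  by move=> [x' [xx ux']]; rewrite (hT _ _ xx).
split; first exact: FE.
split.
- by move=> _ [x _ <-]; rewrite FE; exists (h x).
- move=> _ _ /set_mem[x _ <-] /set_mem[y _ <-]; rewrite !FE => /cls[n xy].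
  (* Equal delay sequences at time i - 2d force equal orbits at time i. *)
  apply/cls; exists (2 * d + n)%N => i ni.
  have := xy (i - 2 * d)%N; rewrite leq_subRL; last by apply: leq_trans ni;
      rewrite leq_addr.
  move=> /(_ ni); rewrite /trajectory !iter_shift_on_range => /(congr1 val) /=.
  move=> /delay_map_eq_iter; rewrite -!iterD subnKC //.
  by apply: leq_trans ni; rewrite leq_addr.
- move=> _ [[z zr] _ <-]; have /set_mem[x _ xz] := zr.
  exists (trajectory_class T x); first by exists x.
  rewrite FE; congr trajectory_class; exact/val_inj.
Qed.

End reconstruction.
End trajectory_embeddings.

(** * Topological entropy *)

Section subadditive_sequences.
Context {R : realType}.

(** The limit is the infimum of the quotients. Dividing n by an m that nearly attains it leaves a
    remainder term bounded by the constant [M], which vanishes after division by n. *)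
Lemma fekete_subadditive (a : nat -> R) : (forall n, 0 <= a n) ->
  (forall m n, a (m + n)%N <= a m + a n) ->
  exists l : R, [/\ 0 <= l, a n / n%:R @[n --> \oo] --> l &
    forall n, l * n%:R <= a n].
Proof.
move=> a0 aD.
pose A := [set a n.+1 / n.+1%:R | n in [set: nat]].
have A0 : lbound A 0 by move=> _ [n _ <-]; rewrite divr_ge0.
have hA : has_inf A by split; [exists (a 1%N / 1%:R), 0%N|exists 0].
have lA n : inf A * n%:R <= a n.
  case: n => [|n]; first by rewrite mulr0.
  rewrite -ler_pdivlMr ?ltr0n //; apply: ge_inf; first by exists 0.
  by exists n.
exists (inf A); split => //; first exact: lb_le_inf hA.1 A0.
have aM m q r : a (q * m + r)%N <= q%:R * a m + a r.
  elim: q => [|q IH]; first by rewrite mul0r add0r.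
  rewrite mulSn -addnA (le_trans (aD _ _)) // -natr1 mulrDl mul1r.
  by rewrite addrAC [leRHS]addrC lerD2l.
apply/cvgrPdist_le => e e0.
have [_ [m _ <-] am] := inf_adherent (divr_gt0 e0 (ltr0Sn R 1)) hA.
pose M := \sum_(r < m.+1) a r.
have aM' r : (r < m.+1)%N -> a r <= M.
  move=> rm; rewrite /M (bigD1 (Ordinal rm)) //= lerDl.
  by apply: sumr_ge0.
have M0 : 0 <= M by apply: sumr_ge0.
have M1 : 0 < M + 1 by rewrite ltr_wpDl.
have eM : 0 < e / 2 / (M + 1) by rewrite !divr_gt0.
have [N _ NP] := near_infty_natSinv_lt (PosNum eM).
exists N.+1 => // -[//|n] /= Nn.
have n0 : 0 < n.+1%:R :> R by rewrite ltr0n.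
rewrite distrC ger0_norm; last by rewrite subr_ge0 ler_pdivlMr.
have Mn : M / n.+1%:R <= e / 2.
  have := ltW (NP n Nn); rewrite /= ler_pdivlMr // => /(le_trans _); apply.
  by rewrite mulrC ler_pM2l ?invr_gt0 // lerDl.
suff h : a n.+1 / n.+1%:R <= a m.+1 / m.+1%:R + M / n.+1%:R.
  rewrite lerBlDl (le_trans h) // [e]splitr addrA; apply: lerD Mn; exact: ltW.
rewrite ler_pdivrMr // mulrDl divfK ?gt_eqF //.
rewrite {1}(divn_eq n.+1 m.+1).
apply: le_trans (aM _ _ _) _; apply: lerD; last by apply: aM'; rewrite ltn_mod.
rewrite mulrC -mulrA; apply: ler_wpM2l => //.
by rewrite ler_pdivlMl ?ltr0n // -natrM ler_nat mulnC leq_trunc_div.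
Qed.

End subadditive_sequences.

Section subcover_numbers.
Context {R : realType}.

(** The form in which compactness enters the counting: it is inherited by iterated covers. *)
Definition finitely_coverable (Z : Type) (U : set (set Z)) :=
  exists2 s : seq (set Z), (forall u, u \in s -> U u) &
    forall z, exists2 u, u \in s & u z.

Lemma compact_finitely_coverable (Z : topologicalType) (U : set (set Z)) :
  compact [set: Z] -> open_cover U -> finitely_coverable U.
Proof.
move=> cZ [oU UT].
have ex z : exists u, U u /\ u z.
  by have : setT z by []; rewrite -UT => -[u Uu uz]; exists u.
have [f fP] := choice ex.
have [z _|s _ sP] := @compact_finite_subcover Z setT f cZ.
  by have [Uz fz] := fP z; apply: open_nbhs_nbhs; split => //; exact: oU.
exists [seq f z | z <- s] => [_ /mapP[z _ ->]|z]; first by have [] := fP z.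
by have [y ys fy] := sP z I; exists (f y) => //; exact: map_f.
Qed.

Lemma subcover_number_le (Z : topologicalType) (U : set (set Z))
    (s : seq (set Z)) :
  (forall u, u \in s -> U u) -> (forall z, exists2 u, u \in s & u z) ->
  subcover_number R U <= (size s)%:R.
Proof.
move=> sU sT.
have fs : finite_set [set` s] by exact: finite_seq.
have [k kE] := proj1 (finite_setP _) fs.
have ks : (k <= size s)%N.
  rewrite -card_le_II; have := kE; rewrite card_eq_le => /andP[_ h].
  apply: card_le_trans h _.
  have sub : [set` s] `<=` (fun i => nth set0 s i) @` `I_(size s).
    move=> u /= us; exists (index u s); first by rewrite /= index_mem.
    exact: nth_index.
  apply: card_le_trans (subset_card_le sub) _; exact: card_image_le.
apply: (@le_trans _ _ k%:R); last by rewrite ler_nat.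
apply: ge_inf; first by exists 0 => _ [m _ <-].
exists k => //; exists [set` s]; split => //.
by apply/seteqP; split=> // z _; have [u us uz] := sT z; exists u.
Qed.

Lemma subcover_number_attained (Z : topologicalType) (U : set (set Z)) :
  finitely_coverable U ->
  exists2 s : seq (set Z), (forall u, u \in s -> U u) /\
    (forall z, exists2 u, u \in s & u z) & subcover_number R U = (size s)%:R.
Proof.
move=> [s0 s0U s0T].
pose K k := exists W : set (set Z),
  [/\ W `<=` U, W #= `I_k & \bigcup_(w in W) w = setT].
have exK : exists k, `[< K k >].
  have [k kE] := proj1 (finite_setP _) (finite_seq s0).
  exists k; apply/asboolP; exists [set` s0]; split => //.
  by apply/seteqP; split=> // z _; have [u us uz] := s0T z; exists u.
case: (ex_minnP exK) => m /asboolP[W [WU Wm WT]] mmin.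
have fW : finite_set W by apply/finite_setP; exists m.
have inW u : (u \in finmap.enum_fset (fset_set W)) = (u \in W).
  exact: in_fset_set.
exists (finmap.enum_fset (fset_set W)).
  split=> [u|z]; first by rewrite inW => /set_mem/WU.
  have : setT z by []; rewrite -WT => -[u Wu uz]; exists u => //.
  by rewrite inW; apply/mem_set.
have -> : size (finmap.enum_fset (fset_set W)) = m by exact: card_fset_set.
apply/eqP; rewrite eq_le; apply/andP; split.
  by apply: ge_inf; [exists 0 => _ [k _ <-]|exists m => //; exists W].
apply: lb_le_inf; first by exists m%:R, m => //; exists W.
by move=> _ [k Kk <-]; rewrite ler_nat; apply: mmin; apply/asboolP.
Qed.

Lemma ln_subcover_number_ge0 (Z : topologicalType) (U : set (set Z)) :
  finitely_coverable U -> 0 <= ln (subcover_number R U).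
Proof.
move=> /subcover_number_attained[s _ ->].
(* An empty subcover occurs only for empty Z, and then the convention ln 0 = 0 applies. *)
by case: (size s) => [|n]; [rewrite ln0|rewrite ln_ge0 // ler1n].
Qed.

(** Choosing a member of U around each intersection turns two minimal subcovers into a cover of at
    most the product size. The maps [h1] and [h2] let the same inequality give subadditivity, with
    an iterate as second map, and the comparison of X with its delay image. *)
Lemma ln_subcover_number_le (Z Z1 Z2 : topologicalType) (U : set (set Z))
    (U1 : set (set Z1)) (U2 : set (set Z2)) (h1 : Z -> Z1) (h2 : Z -> Z2) :
  finitely_coverable U1 -> finitely_coverable U2 ->
  (forall u1 u2, U1 u1 -> U2 u2 ->
     exists2 u, U u & h1 @^-1` u1 `&` h2 @^-1` u2 `<=` u) ->
  ln (subcover_number R U) <=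
    ln (subcover_number R U1) + ln (subcover_number R U2).
Proof.
move=> /subcover_number_attained[s1 [s1U s1T] ->].
move=> /subcover_number_attained[s2 [s2U s2T] ->] UU.
have ex (p : set Z1 * set Z2) : exists u, U1 p.1 -> U2 p.2 ->
    U u /\ h1 @^-1` p.1 `&` h2 @^-1` p.2 `<=` u.
  have [[h h']|h] := pselect (U1 p.1 /\ U2 p.2).
    by have [u] := UU _ _ h h'; exists u.
  by exists set0 => h1' h2'; case: h.
have [phi phiP] := choice ex.
pose s := [seq phi (u1, u2) | u1 <- s1, u2 <- s2].
have : subcover_number R U <= (size s)%:R.
  apply: subcover_number_le.
    move=> _ /allpairsP[[u1 u2] /= [u1s u2s ->]].
    by have [] := phiP (u1, u2) (s1U _ u1s) (s2U _ u2s).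
  move=> z; have [u1 u1s u1z] := s1T (h1 z); have [u2 u2s u2z] := s2T (h2 z).
  exists (phi (u1, u2)); first by apply/allpairsP; exists (u1, u2).
  by have [_] := phiP (u1, u2) (s1U _ u1s) (s2U _ u2s); apply.
rewrite size_allpairs.
have N0 : 0 <= subcover_number R U.
  rewrite /subcover_number; set A := [set _ | _ in _].
  have [->|/set0P ne] := eqVneq A set0; first by rewrite inf0.
  by apply: lb_le_inf => // _ [k _ <-].
have [->|Npos] := eqVneq (subcover_number R U) 0.
  move=> _; rewrite ln0 //; apply: addr_ge0.
    by case: (size s1) => [|n]; [rewrite ln0|rewrite ln_ge0 // ler1n].
  by case: (size s2) => [|n]; [rewrite ln0|rewrite ln_ge0 // ler1n].
have {}Npos : 0 < subcover_number R U by rewrite lt_neqAle eq_sym Npos.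
case: (size s1) => [|n1]; first by rewrite leNgt Npos.
case: (size s2) => [|n2]; first by rewrite muln0 leNgt Npos.
move=> h; rewrite -lnM ?posrE ?ltr0n // -natrM; rewrite ler_ln ?posrE ?ltr0n //.
Qed.

Lemma ln_subcover_number_mono (Z Z1 : topologicalType) (U : set (set Z))
    (U1 : set (set Z1)) (h : Z -> Z1) :
  finitely_coverable U1 ->
  (forall u1, U1 u1 -> exists2 u, U u & h @^-1` u1 `<=` u) ->
  ln (subcover_number R U) <= ln (subcover_number R U1).
Proof.
move=> cU1 UU.
have cT : finitely_coverable [set [set: Z]].
  by exists [:: setT] => [u|z]; [rewrite inE => /eqP ->|exists setT;
      rewrite ?mem_head].
have := @ln_subcover_number_le _ _ _ U _ _ h id cU1 cT.
have -> : ln (subcover_number R [set [set: Z]]) = 0.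
  have : subcover_number R [set [set: Z]] <= (size [:: [set: Z]])%:R.
    apply: subcover_number_le => [u|z]; first by rewrite inE => /eqP ->.
    by exists setT; rewrite ?mem_head.
  have [s _ ->] := subcover_number_attained cT.
  by rewrite ler_nat; case: (size s) => [|[|n]] // _; [rewrite ln0|rewrite ln1].
rewrite addr0; apply=> u1 _ Uu1 ->; have [u Uu sub] := UU _ Uu1.
by exists u => // z [/sub].
Qed.

End subcover_numbers.

Section cover_entropies.
Context {R : realType}.

Lemma iterated_coverP (Z : topologicalType) (g : Z -> Z) (U : set (set Z)) n w :
  iterated_cover g U n w <->
  exists2 u : nat -> set Z, (forall i, (i < n)%N -> U (u i)) &
    w = [set z | forall i, (i < n)%N -> u i (iter i g z)].
Proof.
elim: n w => [|n IH] w /=.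
  split=> [->|[u _ ->]]; last by apply/seteqP; split.
  by exists (fun=> set0) => //; apply/seteqP; split.
split=> [[v [_ [/IH[u uU ->] [u' Uu' <-] ->]]]|[u uU ->]].
  exists (fun i => if i == n then u' else u i).
    by move=> i; rewrite ltnS leq_eqVlt; case: eqP => //= _; exact: uU.
  apply/seteqP; split=> z /= => [[zu zu'] i|zu].
    by rewrite ltnS leq_eqVlt; case: eqP => [-> //|_ /=]; exact: zu.
  split=> [i i_n|]; last by have := zu n; rewrite eqxx; apply.
  by have := zu i; rewrite (ltn_eqF i_n); apply; exact: ltnW.
exists [set z | forall i, (i < n)%N -> u i (iter i g z)], (iter n g @^-1` u n).
split.
- by apply/IH; exists u => // i i_n; apply: uU; exact: ltnW.
- by exists (u n) => //; exact: uU.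
- apply/seteqP; split=> z /= => [zu|[zu zn] i].
    by split=> [i i_n|]; apply: zu => //; exact: ltnW.
  by rewrite ltnS leq_eqVlt => /orP[/eqP ->|] //; exact: zu.
Qed.

Lemma iterated_cover_finitely_coverable (Z : topologicalType) (g : Z -> Z) U n :
  finitely_coverable U -> finitely_coverable (iterated_cover g U n).
Proof.
move=> [s sU sT]; elim: n => [|n [s' s'U s'T]] /=.
  exists [:: setT] => [u|z]; first by rewrite inE => /eqP ->.
  by exists setT; rewrite ?mem_head.
exists [seq u' `&` iter n g @^-1` u | u' <- s', u <- s].
  move=> _ /allpairsP[[u' u] /= [us' us ->]].
  by exists u', (iter n g @^-1` u); split; [exact: s'U|exists u; [exact: sU|]|].
move=> z; have [u' u's u'z] := s'T z; have [u us uz] := sT (iter n g z).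
by exists (u' `&` iter n g @^-1` u) => //; apply/allpairsP; exists (u', u).
Qed.

Definition cover_complexity (Z : topologicalType) (g : Z -> Z) U n : R :=
  ln (subcover_number R (iterated_cover g U n)).

(** An itinerary of length m + n consists of one of length m at z and one of length n at
    [iter m g z], so the complexity is subadditive and the limit exists. *)
Lemma cover_entropyP (Z : topologicalType) (g : Z -> Z) U :
  finitely_coverable U ->
  [/\ 0 <= cover_entropy R g U,
      cover_complexity g U n / n%:R @[n --> \oo] --> cover_entropy R g U &
      forall n, cover_entropy R g U * n%:R <= cover_complexity g U n].
Proof.
move=> cU.
have [n|m n|l [l0 al la]] := @fekete_subadditive R (cover_complexity g U).
- exact/ln_subcover_number_ge0/iterated_cover_finitely_coverable.
- apply: (@ln_subcover_number_le R _ _ _ _ _ _ id (iter m g)).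
  + exact: iterated_cover_finitely_coverable.
  + exact: iterated_cover_finitely_coverable.
  move=> _ _ /iterated_coverP[u uU ->] /iterated_coverP[v vU ->].
  exists [set z | forall i, (i < m + n)%N ->
    (if (i < m)%N then u i else v (i - m)%N) (iter i g z)].
    apply/iterated_coverP.
    exists (fun i => if (i < m)%N then u i else v (i - m)%N) => // i imn.
    case: ltnP => im; first exact: uU.
    by apply: vU; rewrite ltn_subLR.
  move=> z [/= zu zv] i imn; case: ltnP => im; first exact: zu.
  by rewrite -[in iter _ _ _](subnK im) iterD; apply: zv; rewrite ltn_subLR.
- suff -> : cover_entropy R g U = l by [].
  exact: cvg_lim.
Qed.

(** The delay k and the constant c disappear after division by n. They absorb the first k steps of
    an orbit, which the delay image does not determine. *)
Lemma cover_entropy_le (Z Z1 : topologicalType) (g : Z -> Z) (g1 : Z1 -> Z1)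
    U U1 (k : nat) (c : R) :
  finitely_coverable U -> finitely_coverable U1 ->
  (forall n, cover_complexity g U (k + n) <= c + cover_complexity g1 U1 n) ->
  cover_entropy R g U <= cover_entropy R g1 U1.
Proof.
move=> cU cU1 UU1.
have [l0 _ la] := cover_entropyP g cU; have [_ a1l _] := cover_entropyP g1 cU1.
have cl : c / n%:R + cover_complexity g1 U1 n / n%:R @[n --> \oo] -->
    0 + cover_entropy R g1 U1.
  apply: cvgD a1l; rewrite -(mulr0 c); apply: cvgMr.
  by rewrite -(cvg_shiftS (fun n : nat => n%:R^-1 : R)); exact: cvg_harmonic.
rewrite -[leRHS]add0r -(cvg_lim _ cl) //; apply: limr_ge; first exact: cvgP cl.
exists 1%N => // n /= n1; have n0 : 0 < n%:R :> R by rewrite ltr0n.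
rewrite -mulrDl ler_pdivlMr //; apply: le_trans (UU1 n).
apply: le_trans (la _); rewrite ler_wpM2l // ler_nat leq_addl //.
Qed.

End cover_entropies.

Section entropy_of_delay_maps.
Context {R : realType} {X : metricType R}.
Variables (k : nat) (T : continuousType X X) (f : continuousType X R).
Local Notation sg := (@shift_on_range R X T f).
Local Notation I_ := (delay_onto_range T f).

Lemma delay_onto_range_surj z : exists x, I_ x = z.
Proof.
case: z => z zr; have /set_mem[x _ xz] := zr.
by exists x; exact/val_inj.
Qed.

Lemma delay_onto_range_continuous : continuous I_.
Proof.
apply: continuous_comp_initial => x; apply/pointwise_cvgP => j.
apply: (@continuous_comp _ _ _ (iter j T) f); last exact: cts_fun.
exact: continuous_iter (@cts_fun _ _ T) _.
Qed.

Lemma coordinate_continuous (j : nat) :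
  continuous (fun z : set_type (range (delay_map T f)) => (\val z) j).
Proof.
move=> z; apply: (@cvg_comp _ _ _ val (@proj nat (fun=> R) j) (nbhs z)).
  exact: (@initial_continuous _ {ptws nat -> R} val z).
exact: (@proj_continuous nat (fun=> R) j (val z)).
Qed.

Lemma compact_delay_range : compact [set: X] ->
  compact [set: set_type (range (delay_map T f))].
Proof.
move=> cX.
have -> : [set: set_type (range (delay_map T f))] = I_ @` [set: X].
  by apply/seteqP; split=> z // _; have [x <-] := delay_onto_range_surj z;
      exists x.
apply: continuous_compact cX; apply: continuous_subspaceT => x.
exact: delay_onto_range_continuous.
Qed.

Hypothesis delay_determines : forall x y : X,
  delay_map T f x = delay_map T f y -> iter k T x = iter k T y.

(* The iterate T^k is constant on fibres of the delay map, which is a quotient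
   map by compactness. *)
Lemma open_saturated (u : set X) x : compact [set: X] -> open u ->
  u (iter k T x) ->
  exists v, [/\ open v, v (I_ x) & I_ @^-1` v `<=` iter k T @^-1` u].
Proof.
move=> cX ou ux.
have cov : near_covering [set: X] by exact/compact_near_coveringP.
have near_v : \forall z \near I_ x, setT `<=` [set y | I_ y = z ->
    u (iter k T y)].
  apply: (cov _ (nbhs (I_ x)) (fun z y => I_ y = z -> u (iter k T y))) => y _.
  have [xy|ne] := pselect (delay_map T f x = delay_map T f y).
    exists (iter k T @^-1` u, setT); last by move=> [y' z'] [].
    split => /=; last exact: filterT.
    apply: open_nbhs_nbhs; split; last by rewrite /= -(delay_determines xy).
    by apply: open_comp => // z _; exact: continuous_iter (@cts_fun _ _ T) _.
  have [j nej] : exists j, delay_map T f x j != delay_map T f y j.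
    apply: contrapT => nj; apply: ne; apply/funext => j.
    by apply: contrapT => /eqP xyj; apply: nj; exists j.
  pose e := `|delay_map T f x j - delay_map T f y j| / 2.
  have e0 : 0 < e by rewrite divr_gt0 // normr_gt0 subr_eq0.
  have /cvg_ballP/(_ e e0) cx := @coordinate_continuous j (I_ x).
  have /cvg_ballP/(_ e e0) cy := @coordinate_continuous j (I_ y).
  have {}cy := delay_onto_range_continuous cy.
  exists ([set y' | ball (\val (I_ y) j) e (\val (I_ y') j)],
          [set z | ball (\val (I_ x) j) e (\val z j)]) => //.
  move=> [y' z] /= [yy' xz] zE; exfalso; move: nej => /negP; apply.
  apply/negPn/negP => _; rewrite -zE /= in xz.
  have := ball_triangle xz (ball_sym yy').
  by rewrite -splitr -ball_normE /= ltxx.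
exists (interior [set z | setT `<=` [set y | I_ y = z -> u (iter k T y)]]).
split; [exact: open_interior|exact: near_v|].
by move=> y /= /interior_subset /(_ y I); apply.
Qed.

(** For h(T) at most the entropy of the shift, the first k steps of an itinerary in U are recorded
    directly, at the fixed cost [cover_complexity T U k]; step k + i is read off from the i-th shift
    of the delay sequence. The converse is the inequality for factors. *)
Lemma delay_preserves_entropy : compact [set: X] -> preserves_entropy T f.
Proof.
move=> cX; have cY := compact_delay_range cX.
apply/eqP; rewrite eq_le; apply/andP; split; apply: ge_ereal_sup.
  move=> _ [U Uo <-].
  pose V := [set v : set (set_type (range (delay_map T f))) |
    open v /\ exists2 u, U u & I_ @^-1` v `<=` iter k T @^-1` u].
  have Vo : open_cover V.
    split; first by move=> v [].
    apply/seteqP; split=> // z _; have [x <-] := delay_onto_range_surj z.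
    have [oU UT] := Uo.
    have [u Uu ux] : (\bigcup_(u in U) u) (iter k T x) by rewrite UT.
    have [v [ov vx vu]] := open_saturated cX (oU _ Uu) ux.
    by exists v => //; split => //; exists u.
  have cU := compact_finitely_coverable cX Uo.
  have cV := compact_finitely_coverable cY Vo.
  apply: (@le_trans _ _ (cover_entropy R sg V)%:E); last first.
    by apply: ereal_sup_ubound; exists V.
  rewrite lee_fin.
  apply: (@cover_entropy_le _ _ _ _ _ _ _ k (cover_complexity T U k)) => // n.
  apply: (@ln_subcover_number_le R _ _ _ _ _ _ id I_).
  - exact: iterated_cover_finitely_coverable.
  - exact: iterated_cover_finitely_coverable.
  move=> _ _ /iterated_coverP[u uU ->] /iterated_coverP[v vV ->].
  have ex i : exists u', (i < n)%N ->
      U u' /\ I_ @^-1` v i `<=` iter k T @^-1` u'.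
    have [i_n|] := ltnP i n; last by exists set0.
    by have [_ [u' Uu' vu']] := vV i i_n; exists u'.
  have [w wP] := choice ex.
  exists [set x | forall i, (i < k + n)%N ->
    (if (i < k)%N then u i else w (i - k)%N) (iter i T x)].
    apply/iterated_coverP.
    exists (fun i => if (i < k)%N then u i else w (i - k)%N) => // i ikn.
    case: ltnP => ik; first exact: uU.
    by have [] := wP (i - k)%N; first by rewrite ltn_subLR.
  move=> x [/= xu xv] i ikn; case: ltnP => ik; first exact: xu.
  have ikn' : (i - k < n)%N by rewrite ltn_subLR.
  have [_ sub] := wP _ ikn'; rewrite -[in iter _ _ _](subnKC ik) iterD.
  by apply: sub => /=; rewrite -iter_shift_on_range; exact: xv.
move=> _ [V Vo <-].
pose U := [set I_ @^-1` v | v in V].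
have Uo : open_cover U.
  have [oV VT] := Vo; split.
    move=> _ [v Vv <-]; apply: open_comp; last exact: oV.
    by move=> x _; exact: delay_onto_range_continuous.
  apply/seteqP; split=> // x _.
  have [v Vv vx] : (\bigcup_(v in V) v) (I_ x) by rewrite VT.
  by exists (I_ @^-1` v) => //; exists v.
have cU := compact_finitely_coverable cX Uo.
have cV := compact_finitely_coverable cY Vo.
apply: (@le_trans _ _ (cover_entropy R T U)%:E); last first.
  by apply: ereal_sup_ubound; exists U.
rewrite lee_fin; apply: (@cover_entropy_le _ _ _ _ _ _ _ 0 0) => // n.
(* Only subcovers are counted, so an arbitrary section of the delay map may transport them. *)
have [r rP] := choice delay_onto_range_surj.
rewrite add0n add0r.
apply: (@ln_subcover_number_mono R _ _ _ _ r).
  exact: iterated_cover_finitely_coverable.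
move=> _ /iterated_coverP[u uU ->].
have ex i : exists v, (i < n)%N -> V v /\ I_ @^-1` v = u i.
  have [i_n|] := ltnP i n; last by exists set0.
  by have [v Vv vu] := uU i i_n; exists v.
have [v vP] := choice ex.
exists [set z | forall i, (i < n)%N -> v i (iter i sg z)].
  by apply/iterated_coverP; exists v => // i /vP[].
move=> z /= zu i i_n; have := zu i i_n; have [_ <-] := vP i i_n.
by rewrite /= -iter_shift_on_range rP.
Qed.

End entropy_of_delay_maps.

(** * Zero-dimensional sets *)

Section clopen_colorings.
Context {X : topologicalType}.
Implicit Types (A D : set X) (c : X -> nat).

(* A partition of D into N relatively clopen pieces, coded by the color of each
   point. *)
Definition clopen_coloring D (N : nat) c :=
  (forall x, D x -> (c x < N)%N) /\ forall i, closed (D `&` c @^-1` [set i]).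

Lemma closed_color_union D N c (J : set nat) :
  clopen_coloring D N c -> closed (D `&` c @^-1` J).
Proof.
move=> [cN cc].
have -> : D `&` c @^-1` J =
    \bigcup_(i in `I_N `&` J) (D `&` c @^-1` [set i]).
  apply/seteqP; split=> x; first by move=> [Dx Jx]; exists (c x) => //;
      split => //; exact: cN.
  by move=> [i [_ Ji] [Dx xi]]; split => //; rewrite /= [c x]xi.
apply: closed_bigcup => [|i _]; last exact: cc.
by apply: sub_finite_set (finite_II N) => i [].
Qed.

(** Coloring a point by the first piece containing it makes overlapping pieces disjoint, and each
    color class is a finite Boolean combination of relatively clopen sets. *)
Lemma clopen_coloring_of_seq D (s : seq (set X)) :
  (forall p, p \in s -> closed p /\ closed (D `\` p)) ->
  (forall x, D x -> exists2 p, p \in s & p x) -> closed D ->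
  let c x := find (fun p : set X => `[< p x >]) s in
  clopen_coloring D (size s) c /\
  forall x, D x -> nth set0 s (c x) x.
Proof.
move=> sc sD cD c.
have cs x : D x -> (c x < size s)%N.
  move=> Dx; rewrite -has_find; have [p ps px] := sD x Dx.
  by apply/hasP; exists p => //; apply/asboolP.
have cx x : D x -> nth set0 s (c x) x.
  move=> Dx; apply/asboolP; apply: (@nth_find _ set0 (fun p : set X =>
      `[< p x >])).
  by rewrite has_find; exact: cs.
split=> //; split=> // i.
have [si|si] := leqP (size s) i.
  have -> : D `&` c @^-1` [set i] = set0; last exact: closed0.
  by apply/seteqP; split=> // x [Dx ci]; have := cs x Dx; rewrite ci ltnNge si.
have -> : D `&` c @^-1` [set i] = (D `&` nth set0 s i) `&`
    \bigcap_(j in `I_i) (D `\` nth set0 s j).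
  apply/seteqP; split=> x.
    move=> [Dx ci]; split; first by split => //; rewrite -[i]ci; exact: cx.
    move=> j /= ji; split => //; apply/asboolPn.
    have jc : (j < c x)%N by rewrite [c x]ci.
    by rewrite (@before_find _ set0 (fun p : set X => `[< p x >])).
  move=> [[Dx ix] jx]; split => //=.
  have [ci|ic|//] := ltngtP (c x) i.
    by have [_] := jx _ ci; case; exact: cx.
  have := @before_find _ set0 (fun p : set X => `[< p x >]) s i ic.
  by move/asboolPn.
apply: closedI; first by apply: closedI => //;
    have [] := sc _ (mem_nth set0 si).
by apply: closed_bigI => j /= ji;
    have [] := sc _ (mem_nth set0 (ltn_trans ji si)).
Qed.

End clopen_colorings.

Section zero_dimensional_sets.
Context {R : realType} {X : metricType R}.
Hypothesis compactX : compact [set: X].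
Implicit Types A B C P U : set X.

Let closed_compact A : closed A -> compact A.
Proof. by move=> cA; apply: subclosed_compact cA compactX _. Qed.

Let compact_closedX A : compact A -> closed A.
Proof. by apply: compact_closed; exact: metric_hausdorff. Qed.

(** Small inductive dimension at most 0: relatively clopen sets form a base. The empty set is
    included, so it can fill up sequences of such sets. *)
Definition zero_dim A := closed A /\ forall x U, A x -> open U -> U x ->
  exists P, [/\ closed P, closed (A `\` P), P x & P `<=` A `&` U].

(** Smallness is kept abstract because it takes several meanings: missing one of two closed sets,
    lying in a member of a cover, or having a small open neighbourhood. *)
Lemma zero_dim_coloring A (good : set X -> Prop) : zero_dim A ->
  (forall x, A x -> exists U, [/\ open U, U x & good U]) ->
  (forall U V, V `<=` U -> good U -> good V) ->
  exists N c, clopen_coloring A N c /\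
    forall i, (i < N)%N -> good (A `&` c @^-1` [set i]).
Proof.
move=> [cA zA] Agood goodS.
have ex x : exists P, A x ->
    [/\ closed P, closed (A `\` P), P x, P `<=` A & good P].
  have [Ax|] := pselect (A x); last by exists set0.
  have [U [oU Ux gU]] := Agood x Ax.
  have [P [cP cAP Px PU]] := zA x U Ax oU Ux.
  exists P => _; split => //; first by move=> y /PU[].
  by apply: goodS gU => y /PU[].
have [P PP] := choice ex.
have [x Ax|s sA sP] := @compact_finite_subcover X A (fun x =>
    ~` (A `\` P x)) (closed_compact cA).
  have [_ cAP Px _ _] := PP x Ax; apply: open_nbhs_nbhs; split.
    exact: closed_openC.
  by move=> [].
have [|x Ax||[cN cc] cP] := @clopen_coloring_of_seq X A [seq P x | x <- s].
- by move=> _ /mapP[x xs ->]; have [] := PP x (sA x xs).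
- have [y ys yx] := sP x Ax; exists (P y); first exact: map_f.
  by apply: contrapT => nP; apply: yx.
- exact: cA.
exists (size [seq P x | x <- s]), (fun x => find (fun p : set X =>
    `[< p x >]) [seq P x | x <- s]).
split=> // i; rewrite size_map => i_s.
have [x xs xi] : exists2 x, x \in s & nth set0 [seq P x | x <- s] i = P x.
  have : nth set0 [seq P x | x <- s] i \in [seq P x | x <- s].
    by apply: mem_nth; rewrite size_map.
  by move=> /mapP[x xs ->]; exists x.
have [_ _ _ _ gP] := PP x (sA x xs); apply: goodS gP => y [Ay yi].
by rewrite -xi -[i]yi; exact: cP.
Qed.

(** With classes so small that each misses C or C', P is the union of those that meet C. *)
Lemma zero_dim_separation A C C' : zero_dim A -> closed C -> closed C' ->
  C `&` C' = set0 -> exists P, [/\ closed P, closed (A `\` P), P `<=` A,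
    A `&` C `<=` P & P `&` C' = set0].
Proof.
move=> zA cC cC' CC'.
have [x Ax|U V VU|N [c [cN goodc]]] := @zero_dim_coloring A
    (fun U => U `&` C = set0 \/ U `&` C' = set0) zA.
- have [Cx|nCx] := pselect (C x).
    exists (~` C'); split; [exact: closed_openC| |right; exact: setICl].
    by move=> C'x; have : (C `&` C') x by []; rewrite CC'.
  by exists (~` C); split; [exact: closed_openC| |left; exact: setICl].
- by move=> [h|h]; [left|right]; apply/seteqP; split=> // x [Vx Cx];
    rewrite -h; split => //; exact: VU.
pose J := [set i | A `&` c @^-1` [set i] `&` C !=set0].
exists (A `&` c @^-1` J); split.
- exact: closed_color_union cN.
- have -> : A `\` (A `&` c @^-1` J) = A `&` c @^-1` (~` J).
    apply/seteqP; split=> x [Ax nJ]; split => //=; first by move=> Jx;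
        apply: nJ.
    by move=> [].
  exact: closed_color_union cN.
- by move=> x [].
- by move=> x [Ax Cx]; split => //; exists x.
- apply/seteqP; split=> // x [[Ax [y [[Ay yx] Cy]]] C'x].
  have [h|h] := goodc (c x) (cN.1 x Ax); last by rewrite -h.
  by have : (A `&` c @^-1` [set c x] `&` C) y by []; rewrite h.
Qed.

Lemma zero_dim_dim A : zero_dim A -> A !=set0 -> dim_eq (set_type A) 0.
Proof.
move=> zA [a Aa]; split; last first.
  move=> /(_ 1%N (fun=> setT)) [||m [V [_ VT _ V0]]].
  - by move=> _; exact: openT.
  - by apply/seteqP; split=> // z _; exists ord0.
  pose z : set_type A := exist _ a (mem_set Aa).
  have [j _ Vj] : (\bigcup_j V j) z by rewrite VT.
  have := V0 z; rewrite leqn0 cards_eq0 => /eqP/setP/(_ j).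
  by rewrite !inE => /asboolP; apply.
move=> k U oU UT.
have [x Ax|W V VW [i Wi]|N [c [cN goodc]]] := @zero_dim_coloring A
    (fun W => exists i, val @^-1` W `<=` U i) zA.
- pose z : set_type A := exist _ x (mem_set Ax).
  have [i _ Ui] : (\bigcup_i U i) z by rewrite UT.
  have [W oW WU] := oU i; exists W; split => //; last by exists i; rewrite WU.
  by have : (val @^-1` W) z by rewrite WU.
- by exists i => z /VW /Wi.
exists N, (fun j : 'I_N => [set z : set_type A | c (val z) = j]); split.
- move=> j.
  have -> : [set z : set_type A | c (val z) = j] =
      val @^-1` (~` (A `&` c @^-1` [set i : nat | i <> j])).
    apply/seteqP; split=> z /= => [cz [_ /(_ cz)] //|nAz].
    by apply: contrapT => cz; apply: nAz; split => //; exact: set_mem (valP z).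
  exists (~` (A `&` c @^-1` [set i : nat | i <> j])) => //.
  by apply: closed_openC; exact: closed_color_union cN.
- apply/seteqP; split=> // z _.
  by exists (Ordinal (cN.1 _ (set_mem (valP z)))).
- move=> j; have [i ji] := goodc j (ltn_ord j); exists i => z cz; apply: ji.
  by split => //; exact: set_mem (valP z).
- move=> z; apply/card_le1_eqP => i j; rewrite !inE /= => iz jz.
  by apply: ord_inj; rewrite -iz -jz.
Qed.

(** A refinement of order one of the cover by U and the complement of x consists of disjoint open
    pieces. The piece through x is not inside the complement of x, so it lies in U. *)
Lemma dim_zero_dim A B : dim_le (set_type A) 0 -> closed B -> B `<=` A ->
  zero_dim B.
Proof.
move=> dA cB BA; split=> // x U Bx oU Ux.
have cx : closed [set x] by apply: compact_closedX; exact: compact_set1.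
pose C (i : 'I_2) : set X := if i == ord0 then U else ~` [set x].
have oC i : open (C i) by rewrite /C; case: eqP => // _; exact: closed_openC.
have [||m [V [oV VT VC V1]]] := dA 2 (fun i => val @^-1` C i).
- by move=> i; exists (C i).
- apply/seteqP; split=> // z _; have [zx|zx] := pselect (val z = x).
    by exists ord0 => //=; rewrite /C /= zx.
  by exists ord_max.
have exW j : exists W, open W /\ val @^-1` W = V j.
  by have [W oW WV] := oV j; exists W.
have [W WP] := choice exW.
have oW j : open (W j) by have [] := WP j.
have WV j : val @^-1` W j = V j by have [] := WP j.
pose pt y (Ay : A y) : set_type A := exist _ y (mem_set Ay).
have WT y : B y -> exists j, W j y.
  move=> By; have [j _ Vj] : (\bigcup_j V j) (pt y (BA _ By)) by rewrite VT.
  by exists j; rewrite -WV in Vj.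
have Winj y i j : B y -> W i y -> W j y -> i = j.
  move=> By Wi Wj; have Vi : V i (pt y (BA _ By)) by rewrite -WV.
  have Vj : V j (pt y (BA _ By)) by rewrite -WV.
  apply/esym/(card_le1_eqP (V1 (pt y (BA _ By)))).
  - by rewrite inE; apply/asboolP.
  - by rewrite inE; apply/asboolP.
have [j Wjx] := WT x Bx.
exists (B `&` W j); split => //.
- have -> : B `&` W j = B `\` \bigcup_(i in [set i | i != j]) W i.
    apply/seteqP; split=> y [By Wy]; split => //.
      by move=> [i /= /eqP ij Wi]; apply: ij; exact: Winj Wi Wy.
    have [i Wi] := WT y By; have [<- //|ij] := eqVneq i j.
    by exfalso; apply: Wy; exists i.
  by rewrite setDE; apply: closedI => //; apply/open_closedC/bigcup_open.
- have -> : B `\` (B `&` W j) = B `\` W j.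
    apply/seteqP; split=> y [By h]; split => //; last by move=> [].
    by move=> Wy; apply: h.
  by rewrite setDE; apply: closedI => //; exact: open_closedC.
- have [i Vji] := VC j; have := Vji (pt x (BA _ Bx)).
  rewrite -WV => /(_ Wjx) /=; rewrite /C; case: eqP => [i0 _|_ /(_ erefl) //].
  move=> y [By Wy]; split => //; have := Vji (pt y (BA _ By)).
  by rewrite -WV => /(_ Wy); rewrite /C i0.
Qed.

Lemma zero_dim_image (T : X -> X) A : continuous T -> doubly_zero_dim T ->
  zero_dim A -> zero_dim (T @` A).
Proof.
move=> cT dT zA; have [cA _] := zA.
have cTA : closed (T @` A).
  apply: compact_closedX; apply: continuous_compact; last exact: closed_compact.
  exact: continuous_subspaceT.
have [->|/set0P A0] := eqVneq A set0; first by rewrite image_set0; split => //;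
    exact: closed0.
have [_ [dTA _]] := dT A cA (zero_dim_dim zA A0).
exact: dim_zero_dim dTA cTA _.
Qed.

End zero_dimensional_sets.

(** * Separators *)

Section hits.
Context {X : topologicalType}.
Implicit Types L : nat -> set X.

Definition hits L (K : nat) (x : X) : nat := \sum_(0 <= i < K) `[< L i x >].

Lemma hitsS L K x : hits L K.+1 x = (hits L K x + `[< L K x >])%N.
Proof. by rewrite /hits big_nat_recr. Qed.

Lemma hits_mono L K K' x : (K <= K')%N -> (hits L K x <= hits L K' x)%N.
Proof. by move=> KK'; rewrite /hits (big_cat_nat (leq0n K) KK') //= leq_addr.
    Qed.

Lemma closed_hits L (K n : nat) : (forall i, closed (L i)) ->
  closed [set x | (n <= hits L K x)%N].
Proof.
move=> cL; elim: K n => [|K IH] [|n].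
- by have -> : [set x | (0 <= hits L 0 x)%N] = setT;
    [apply/seteqP|exact: closedT].
- have -> : [set x | (n.+1 <= hits L 0 x)%N] = set0; last exact: closed0.
  by apply/seteqP; split=> // x /=; rewrite /hits big_geq.
- by have -> : [set x | (0 <= hits L K.+1 x)%N] = setT;
    [apply/seteqP|exact: closedT].
have -> : [set x | (n.+1 <= hits L K.+1 x)%N] =
    [set x | (n.+1 <= hits L K x)%N] `|` [set x | (n <= hits L K x)%N] `&` L K.
  apply/seteqP; split=> x /=; rewrite hitsS; case: asboolP => Lx.
  - by rewrite addn1 ltnS; right.
  - by rewrite addn0; left.
  - by rewrite addn1 ltnS => -[/ltnW|[]].
  - by rewrite addn0 => -[|[]].
by apply: closedU => //; apply: closedI.
Qed.

End hits.

Section fattening.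
Context {R : realType} {X : metricType R}.
Hypothesis compactX : compact [set: X].

Definition closed_pairs (I : Type) (P : I -> bool -> set X) :=
  (forall i b, closed (P i b)) /\ forall i, P i true `&` P i false = set0.

Definition open_pairs (I : Type) (G : I -> bool -> set X) :=
  (forall i b, open (G i b)) /\ forall i, G i true `&` G i false = set0.

Lemma normalX : normal_space X.
Proof. exact: compact_normal (@metric_hausdorff _ _) compactX. Qed.

Lemma fatten_pairs (I : Type) (P : I -> bool -> set X) : closed_pairs P ->
  exists P', closed_pairs P' /\ forall i b, P i b `<=` interior (P' i b).
Proof.
move=> [cP dP].
have sep (A B : set X) : closed A -> closed B -> A `&` B = set0 ->
    exists F, [/\ closed F, A `<=` interior F & F `&` B = set0].
  move=> cA cB AB; have := proj1 (@normal_openP R X) normalX A B cA cB AB.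
  move=> [U [V [oU oV AU BV UV]]]; exists (~` V); split.
  - exact: open_closedC.
  - move=> x /AU Ux; apply: (@filterS _ (nbhs x) _ U).
      2: by apply: open_nbhs_nbhs.
    by move=> y Uy Vy; have : (U `&` V) y by []; rewrite UV.
  - by apply/seteqP; split=> // x [nVx /BV].
have ex i : exists F, [/\ closed F.1, closed F.2, P i true `<=` interior F.1,
    P i false `<=` interior F.2 & F.1 `&` F.2 = set0].
  have [F1 [cF1 PF1 F1P]] := sep _ _ (cP i true) (cP i false) (dP i).
  (* The second side is fattened against [F1], not against [P i true], so that the fattened sides
     stay disjoint. *)
  have [|F2 [cF2 PF2 F2F1]] := sep _ _ (cP i false) cF1; first by rewrite setIC.
  by exists (F1, F2); split => //=; rewrite setIC.
have [F FP] := choice ex.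
exists (fun i b => if b then (F i).1 else (F i).2); split.
  by split=> [i []|i]; have [] := FP i.
by move=> i []; have [] := FP i.
Qed.

(* Both infinite constructions of separators alternate a fattening of all pairs
   with a step that achieves one more of the countably many requirements Q. *)
Lemma fattening_sequence (I : Type) (P : I -> bool -> set X)
    (Q : nat -> (I -> bool -> set X) -> Prop) :
  closed_pairs P ->
  (forall N P1, closed_pairs P1 ->
     exists P2, [/\ closed_pairs P2, Q N P2 & forall i b,
         P1 i b `<=` P2 i b]) ->
  exists G, [/\ open_pairs G, forall i b, P i b `<=` G i b &
    forall N, exists2 P2, Q N P2 & forall i b, P2 i b `<=` G i b].
Proof.
move=> cP step.
pose good (s s' : nat * (I -> bool -> set X)) := s'.1 = s.1.+1 /\
  (closed_pairs s.2 -> exists P2, [/\ Q s.1 P2, closed_pairs s'.2,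
     forall i b, s.2 i b `<=` P2 i b &
     forall i b, P2 i b `<=` interior (s'.2 i b)]).
have goodE s : {s' | good s s'}.
  apply: cid; case: s => N P1; have [cP1|ncP1] := pselect (closed_pairs P1).
    have [P2 [cP2 QP2 P12]] := step N P1 cP1.
    have [P3 [cP3 P23]] := fatten_pairs cP2.
    by exists (N.+1, P3); split => // _; exists P2.
  by exists (N.+1, P1).
have [s [s0 sS]] := dependent_choice goodE (0%N, P).
have sN N : (s N).1 = N.
  by elim: N => [|N IH]; [rewrite s0|have [-> _] := sS N; rewrite IH].
have cs N : closed_pairs (s N).2.
  elim: N => [|N IH]; first by rewrite s0.
  by have [_ /(_ IH)[P2 []]] := sS N.
have sint N i b : (s N).2 i b `<=` interior ((s N.+1).2 i b).
  have [_ /(_ (cs N))[P2 [_ _ h1 h2]]] := sS N.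
  exact: subset_trans (h1 i b) (h2 i b).
have smono N M i b : (N <= M)%N -> (s N).2 i b `<=` (s M).2 i b.
  move=> /subnK <-; elim: (M - N)%N => [|k IH] //; rewrite addSn.
  by apply: subset_trans IH _ => x /sint; exact: interior_subset.
(* Interiors make the limit sides open; nothing is lost, since each stage lies in the interior of
   the next. *)
exists (fun i b => \bigcup_N interior ((s N).2 i b)); split.
- split=> [i b|i]; first by apply: bigcup_open => N _; exact: open_interior.
  apply/seteqP; split=> // x [[N _ /interior_subset xN] [M _ /interior_subset
      xM]].
  have [_ /(_ i) <-] := cs (maxn N M); split.
    exact: smono (leq_maxl _ _) _ xN.
  exact: smono (leq_maxr _ _) _ xM.
- by move=> i b x Px; exists 1%N => //; apply: sint; rewrite s0.
- move=> N; have [_ /(_ (cs N))[P2 [QP2 _ _ h2]]] := sS N.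
  by rewrite sN in QP2; exists P2 => // i b x /h2 xN; exists N.+1.
Qed.

(** Stage n splits [Z n] into two closed parts and adds one to each side. In the limit the closed
    separator left between the open sides misses every [Z n]. *)
Lemma zero_dim_separator (C C' : set X) (Z : nat -> set X) :
  closed C -> closed C' -> C `&` C' = set0 -> (forall n, zero_dim (Z n)) ->
  exists G G', [/\ open G, open G', G `&` G' = set0, C `<=` G & C' `<=` G'] /\
    forall n, Z n `<=` G `|` G'.
Proof.
move=> cC cC' CC' zZ.
have [||G [[oG dG] PG QG]] := @fattening_sequence unit
    (fun _ b => if b then C else C')
    (fun n P => Z n `<=` P tt true `|` P tt false).
- by split=> [_ []|_].
- move=> n P1 [cP1 dP1].
  have [A [cA cZA AZ ZA AP]] := zero_dim_separation compactX (zZ n)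
    (cP1 tt true) (cP1 tt false) (dP1 tt).
  exists (fun _ b => P1 tt b `|` (if b then A else Z n `\` A)); split.
  + split=> [_ []|_]; [exact: closedU|exact: closedU|].
    apply/seteqP; split=> // x [[P1x|Ax] [P1'x|[Zx nAx]]].
    * by rewrite -(dP1 tt).
    * by apply: nAx; apply: ZA.
    * by rewrite -AP.
    * by [].
  + by move=> x Zx; have [Ax|nAx] := pselect (A x); [left; right|right; right].
  + by move=> [] b x P1x; left.
exists (G tt true), (G tt false); split.
  by split=> //; [exact: (PG tt true)|exact: (PG tt false)].
by move=> n x Zx; have [P2 /(_ x Zx)[h|h] P2G] := QG n; [left|right];
    exact: P2G h.
Qed.

(* This plays the role of dim A < n for closed A: removing countably many
   zero-dimensional sets lowers the dimension of all compact subsets. *)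
Fixpoint rdim (n : nat) (A : set X) : Prop :=
  if n is n'.+1 then
    exists2 Z : nat -> set X, forall i, zero_dim (Z i) &
      forall C, closed C -> C `<=` A -> (forall i, C `&` Z i = set0) ->
          rdim n' C
  else A = set0.

Lemma rdim_subset n A B : rdim n A -> B `<=` A -> rdim n B.
Proof.
case: n => [|n] /= => [-> BA|[Z zZ ZA] BA].
  by apply/seteqP; split.
by exists Z => // C cC CB; apply: ZA => //; exact: subset_trans BA.
Qed.

(** A finite sum theorem: the two sequences of witnesses are interleaved by parity, and a closed set
    avoiding both splits into its closed parts in A and in B. *)
Lemma rdimU n A B : closed A -> closed B -> rdim n A -> rdim n B ->
  rdim n (A `|` B).
Proof.
elim: n A B => [|n IH] A B cA cB /=; first by move=> -> ->; rewrite setU0.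
move=> [ZA zZA hA] [ZB zZB hB].
exists (fun i => if odd i then ZB i./2 else ZA i./2) => [i|C cC CAB CZ].
  by case: ifP.
have -> : C = (C `&` A) `|` (C `&` B).
  by apply/seteqP; split=> x; [move=> /[dup] /CAB[];
      [left|right]|move=> [[]|[]]].
apply: IH; [exact: closedI|exact: closedI| |].
  apply: hA => [|x []|i] //; first exact: closedI.
  have := CZ i.*2; rewrite odd_double doubleK => h.
  by apply/seteqP; split=> // x [[Cx _] Zx]; rewrite -h.
apply: hB => [|x []|i] //; first exact: closedI.
have := CZ i.*2.+1; rewrite /= odd_double /= uphalf_double => h.
by apply/seteqP; split=> // x [[Cx _] Zx]; rewrite -h.
Qed.

(* In the inductive step, the points of A lying on n of the first K separators
   lie on no later one, and the later pairs still separate points. *)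
Lemma rdim_separator_order (G : nat -> bool -> set X) n A : open_pairs G ->
  (forall x U K, open U -> U x ->
     exists k, [/\ (K <= k)%N, G k true x & ~` U `<=` G k false]) ->
  closed A ->
  (forall x K, A x -> (hits (fun k =>
      ~` (G k true `|` G k false)) K x < n)%N) ->
  rdim n A.
Proof.
move=> [oG dG] sepG; set L := fun k => _.
have cL k : closed (L k) by apply: open_closedC; exact: openU.
elim: n A => [|n IH] A cA An /=.
  by apply/seteqP; split=> // x Ax; have := An x 0%N Ax.
exists (fun K => A `&` [set x | (n <= hits L K x)%N]) => [K|C cC CA CZ].
  have cZ : closed (A `&` [set x | (n <= hits L K x)%N]).
    by apply: closedI => //; exact: closed_hits.
  split=> // x U [Ax xn] oU Ux; have [k [Kk Gx GU]] := sepG x U K oU Ux.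
  have ZG y : (A `&` [set x | (n <= hits L K x)%N]) y ->
      G k true y \/ G k false y.
    move=> [Ay ny]; apply: contrapT => Ly; have := An y k.+1 Ay.
    rewrite hitsS (_ : `[< L k y >] = true); last by apply/asboolP.
    by rewrite addn1 ltnS ltnNge (leq_trans ny) // hits_mono.
  set Z := A `&` _ in cZ ZG *.
  have TF y : G k true y -> G k false y -> False.
    by move=> h h'; have : (G k true `&` G k false) y by []; rewrite dG.
  exists (Z `&` G k true); split.
  - have -> : Z `&` G k true = Z `&` ~` G k false.
      apply/seteqP; split=> y [Zy Gy]; split => //; first by move=> /(TF _ Gy).
      by have [|/Gy] := ZG _ Zy.
    by apply: closedI => //; exact: open_closedC.
  - have -> : Z `\` (Z `&` G k true) = Z `&` ~` G k true.
      apply/seteqP; split=> y [Zy Gy]; split => //; first by move=> h;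
          apply: Gy.
      by move=> [].
    by apply: closedI => //; exact: open_closedC.
  - by [].
  - move=> y [[Ay ny] Gy]; split => //; apply: contrapT => /GU.
    exact: TF Gy.
apply: IH => // x K Cx; rewrite ltnNge; apply/negP => nx.
have : (C `&` (A `&` [set x | (n <= hits L K x)%N])) x by split=> //;
    split=> //; exact: CA.
by rewrite CZ.
Qed.

End fattening.

(** * From covering dimension to sequences of separators *)

Section separators_from_covering_dimension.
Context {R : realType} {X : metricType R}.
Hypothesis compactX : compact [set: X].

Definition gap (P : nat -> bool -> set X) (k : nat) : set X :=
  ~` (P k true `|` P k false).

Lemma hitsE (L : nat -> set X) K x :
  hits L K x = #|[set k : 'I_K | `[< L k x >]]%SET|.
Proof.
rewrite /hits big_mkord -sum1_card [RHS]big_mkcond /=.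
by apply: eq_bigr => i _; rewrite inE; case: asbool.
Qed.

Lemma hits_subset (L L' : nat -> set X) K x :
  (forall k, L k `<=` L' k) -> (hits L K x <= hits L' K x)%N.
Proof.
move=> LL'; rewrite !hitsE; apply/subset_leq_card/fintype.subsetP => k.
by rewrite !inE => Lk; apply: LL'.
Qed.

(** Urysohn functions for a closed shrinking [F] of the cover. The value 1 is attained by some
    function at each point, which leaves room for many disjoint bands of levels strictly between 0
    and 1. *)
Lemma bump_functions (m : nat) (V : 'I_m -> set X) :
  (forall w, open (V w)) -> \bigcup_w V w = setT ->
  exists phi : 'I_m -> X -> R, [/\ forall w, continuous (phi w),
    forall w x, 0 <= phi w x, forall w x, ~ V w x -> phi w x = 0 &
    forall x, exists w, phi w x = 1].
Proof.
move=> oV VT.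
have ex x : exists w, V w x.
  have [w _ Vw] : (\bigcup_w V w) x by rewrite VT.
  by exists w.
have [w wP] := choice ex.
have [|N [[cN dN] PN]] := fatten_pairs compactX
    (P := fun x b => if b then [set x] else ~` V (w x)).
  split=> [x []|x].
  - by apply: compact_closed; [exact: metric_hausdorff|exact: compact_set1].
  - exact: open_closedC.
  - by apply/seteqP; split=> // y [->]; apply.
have [x _|s _ sP] := compact_finite_subcover (f := fun x => N x true) compactX.
  exact: (PN x true x erefl).
pose F v := \bigcup_(x in [set x | x \in s /\ w x = v]) N x true.
have cF v : closed (F v).
  apply: closed_bigcup => [|x _]; last exact: cN.
  by apply: sub_finite_set (finite_seq s) => x [].
have VF v : ~` V v `&` F v = set0.
  apply/seteqP; split=> // y [nVy [x [_ xv] Nxy]].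
  rewrite -(dN x); split => //; apply: interior_subset.
  by apply: (PN x false y); rewrite xv.
have urysohn v : exists f : X -> R, [/\ continuous f, forall x, 0 <= f x,
    forall x, ~ V v x -> f x = 0 & forall x, F v x -> f x = 1].
  have := proj1 (@normal_separatorP R X) (normalX compactX) (~` V v) (F v)
    (open_closedC (oV v)) (cF v) (VF v).
  move=> /(uniform_separatorP (R := R))[f [cf f01 f0 f1]].
  exists f; split => // x.
  - have : range f (f x) by exists x.
    by move=> /f01 /=; rewrite in_itv /= => /andP[].
  - by move=> nVx; apply: f0; exists x.
  - by move=> Fx; apply: f1; exists x.
have [phi phiP] := choice urysohn.
exists phi; split=> [v|v x|v x|x]; try by have [] := phiP v.
  by have [_ _ + _] := phiP v; apply.
have [y ys yx] := sP x I; exists (w y); have [_ _ _] := phiP (w y); apply.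
by exists y.
Qed.

(* With V of order at most n and gap k squeezed between consecutive levels of
   the bump functions, distinct gaps through x need distinct members of V
   through x, none of them the one whose bump function is 1 at x. *)
Lemma finite_separators (n K : nat) (P : nat -> bool -> set X) :
  dim_lt X n -> closed_pairs P ->
  exists P', [/\ closed_pairs P', forall x, (hits (gap P') K x < n)%N &
    forall k b, P k b `<=` P' k b].
Proof.
move=> dX [cP dP].
(* Each member of this cover omits one side of every pair k < K, so no member of a refinement meets
   both sides of such a pair. *)
pose U (i : 'I_#|{ffun 'I_K -> bool}|) : set X :=
  ~` \bigcup_(k in [set: 'I_K]) P k (enum_val i k).
have [i||m [V [oV VT VU Vn]]] := dX _ U.
- by apply/closed_openC/closed_bigcup => //; exact: finite_finset.
- apply/seteqP; split=> // x _.
  pose s := [ffun k : 'I_K => ~~ `[< P k true x >]].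
  exists (enum_rank s) => // -[k _]; rewrite enum_rankK ffunE.
  case: asboolP => //= Px Px'.
  by have : (P k true `&` P k false) x by []; rewrite dP.
have [phi [cphi phi0 phiV phi1]] := bump_functions oV VT.
pose A k w := V w `&` P k true !=set0.
(* The bands from (2k+1)r to (2k+2)r, for k < K, are disjoint and lie strictly between 0 and 1. At a
   point of the gap of pair k some bump function indexed by [A k] takes a value in band k. *)
pose r : R := (2 * K.+1)%:R^-1.
have r0 : 0 < r by rewrite invr_gt0 ltr0n.
pose T k := \bigcup_(w in A k) [set x | (2 * k + 2)%:R * r <= phi w x].
pose F k := \bigcap_(w in A k) [set x | phi w x <= (2 * k + 1)%:R * r].
pose P' k b := if (k < K)%N then (if b then T k else F k) else P k b.
have level a b : ((a%:R * r < b%:R * r) = (a < b)%N).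
  by rewrite ltr_pM2r // ltr_nat.
exists P'; split.
- split=> [k b|k]; rewrite /P'; case: ifP => // kK; last first.
    apply/seteqP; split=> // x [[w Aw /= h1] /(_ w Aw) /= h2].
    by have := le_trans h1 h2; rewrite leNgt level ltn_add2l.
  case: b; last first.
    apply: closed_bigI => w _;
        apply: (@preimage_closed _ _ (phi w) [set y | y <= _]).
      by move=> x _; exact: cphi.
    exact: closed_le.
  apply: closed_bigcup => [|w _]; first exact: finite_finset.
  apply: (@preimage_closed _ _ (phi w) [set y | _ <= y]); last exact: closed_ge.
  by move=> x _; exact: cphi.
- move=> x; rewrite hitsE; set S := [set k | _]%SET.
  have ex (k : 'I_K) : exists w, k \in S ->
      (2 * k + 1)%:R * r < phi w x < (2 * k + 2)%:R * r.
    have [kS|kS] := boolP (k \in S); last by have [w _] := phi1 x; exists w.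
    move: kS; rewrite inE /gap /P' ltn_ord => /asboolP nTF.
    have nT : ~ T k x by move=> h; apply: nTF; left.
    have nF : ~ F k x by move=> h; apply: nTF; right.
    have [w wP] : exists w, A k w /\ ~ (phi w x <= (2 * k + 1)%:R * r).
      apply: contrapT => nw; apply: nF => w Aw /=; apply: contrapT => h.
      by apply: nw; exists w.
    exists w => _; have [Aw /negP] := wP; rewrite -ltNge => -> /=.
    by rewrite ltNge; apply/negP => h; apply: nT; exists w.
  have [w wP] := choice ex; have [w1 w1x] := phi1 x.
  have w_inj : {in S &, injective w}.
    move=> k k' kS k'S ww'; apply: ord_inj.
    have /andP[h1 h2] := wP k kS; have /andP[h3 h4] := wP k' k'S.
    rewrite ww' in h1 h2; have := lt_trans h1 h4; have := lt_trans h3 h2.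
    rewrite !level; lia.
  have Vw v : 0 < phi v x -> V v x.
    by move=> h; apply: contrapT => /phiV h0; rewrite h0 ltxx in h.
  apply: leq_trans (Vn x); rewrite -(card_in_imset w_inj).
  have w1S : w1 \notin [set w k | k in S]%SET.
    apply/negP => /imsetP[k kS ww1]; have /andP[_] := wP k kS.
    rewrite -ww1 w1x /r ltr_pdivlMr ?ltr0n // mul1r ltr_nat.
    by have := ltn_ord k; lia.
  have := cardsU1 w1 [set w k | k in S]%SET; rewrite w1S add1n => <-.
  apply/subset_leq_card/fintype.subsetP => v; rewrite !inE => /orP[/eqP->|].
    by apply: Vw; rewrite w1x.
  move=> /imsetP[k kS ->]; apply: Vw.
  have /andP[h _] := wP k kS; apply: le_lt_trans h.
  by rewrite mulr_ge0 // ltW.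
- move=> k b x Px; rewrite /P'; case: ifP => // kK; case: b Px => Px.
    have [w wx] := phi1 x; exists w => /=.
      exists x; split => //; apply: contrapT => /phiV; rewrite wx.
      by move/eqP; rewrite oner_eq0.
    rewrite wx /r ler_pdivrMr ?ltr0n // mul1r ler_nat; lia.
  move=> w [y [Vy Py]] /=; rewrite phiV; first by rewrite mulr_ge0 // ltW.
  move=> Vx; have [i Vi] := VU w.
  have nx := Vi _ Vx; have ny := Vi _ Vy.
  case ik: (enum_val i (Ordinal kK)).
    by apply: ny; exists (Ordinal kK) => //; rewrite ik.
  by apply: nx; exists (Ordinal kK) => //; rewrite ik.
Qed.

Lemma closure_ball_interior (y : X) (r : R) : 0 < r ->
  closure (ball y r) `<=` interior (ball y (2 * r)).
Proof.
move=> r0 x yx; have e0 : 0 < r / 2 by rewrite divr_gt0.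
have [z [yz xz]] := yx _ (nbhsx_ballx x _ e0).
apply: filterS (nbhsx_ballx x _ e0) => t xt.
apply: (@le_ball _ _ _ (r + (r / 2 + r / 2))).
  by rewrite -splitr mulr2n mulrDl mul1r.
apply: ball_triangle yz _; exact: ball_triangle (ball_sym xz) xt.
Qed.

Lemma exists_separating_pairs : exists P : nat -> bool -> set X,
  closed_pairs P /\ forall x U K, open U -> U x ->
    exists k, [/\ (K <= k)%N, P k true x & ~` U `<=` P k false].
Proof.
pose rho (j : nat) : R := j.+1%:R^-1.
have rho0 j : 0 < rho j by rewrite invr_gt0.
have net j : exists s : seq X, forall x, exists2 y, y \in s & ball y (rho j) x.
  have [x _|s _ sP] := compact_finite_subcover (f :=
      fun y => ball y (rho j)) compactX.
    exact: nbhsx_ballx.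
  by exists s => x; exact: sP.
have [s sP] := choice net.
pose B j i b : set X := if onth (s j) i is Some y then
  if b then closure (ball y (rho j)) else ~` (interior (ball y (2 * rho j)))
  else set0.
(* The third coordinate repeats each pair infinitely often, so a separating pair can be found beyond
   any index K. *)
pose P k b := if @unpickle (nat * nat * nat)%type k is Some (j, i, _)
  then B j i b else set0.
have cB j i b : closed (B j i b).
  rewrite /B; case: (onth (s j) i) => [y|]; last exact: closed0.
  by case: b; [exact: closed_closure|apply/open_closedC/open_interior].
have dB j i : B j i true `&` B j i false = set0.
  rewrite /B; case: (onth (s j) i) => [y|]; last by rewrite setI0.
  apply/seteqP; split=> // x [xy]; apply; exact: closure_ball_interior xy.
exists P; split.
  split=> [k b|k]; rewrite /P.
    by case: unpickle => [[[j i] l]|]; [exact: cB|exact: closed0].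
  by case: unpickle => [[[j i] l]|]; [exact: dB|rewrite setI0].
move=> x U K oU Ux.
have /nbhs_ballP[e /= e0 eU] := open_nbhs_nbhs (conj oU Ux).
have [j _ /(_ j (leqnn j)) /= je] :=
    near_infty_natSinv_lt (PosNum (divr_gt0 e0 (ltr0Sn R 2))).
have [y ys yx] := sP j x.
have /onthP[i iy] := ys.
have [l Kl] : exists l : nat, (K <= pickle (j, i, l))%N.
  apply: contrapT => nl.
  have lt (l : nat) : (pickle (j, i, l) < K)%N.
    by rewrite ltnNge; apply/negP => h; apply: nl; exists l.
  have /leq_card : injective (fun l : 'I_K.+1 => Ordinal (lt l)).
    move=> a b /(congr1 val) /= /(pcan_inj pickleK) [ab]; exact: ord_inj.
  by rewrite !card_ord ltnn.
exists (pickle (j, i, l)); rewrite /P pickleK /B iy.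
split => //; first exact: subset_closure.
apply: subsetC => z /interior_subset yz; apply: eU.
apply: (@le_ball _ _ _ (rho j + 2 * rho j)); first by move: je;
    rewrite -/(rho j); lra.
exact: ball_triangle (ball_sym yx) yz.
Qed.

(** Requirement N asks that fewer than n of the first N gaps pass through any point. Enlarging the
    sides only shrinks the gaps, so every requirement survives in the limit. *)
Lemma rdim_dim_lt n : dim_lt X n -> rdim n [set: X].
Proof.
move=> dX; have [P [cP sepP]] := exists_separating_pairs.
have [N P1 cP1|G [oG PG QG]] := fattening_sequence compactX
    (Q := fun N P1 => forall x, (hits (gap P1) N x < n)%N) cP.
  exact: finite_separators.
apply: (rdim_separator_order oG) => [x U K oU Ux| |x K _].
- have [k [Kk Px UP]] := sepP x U K oU Ux; exists k; split => //.
    exact: PG.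
  by apply: subset_trans UP _; exact: PG.
- exact: closedT.
have [P2 P2n P2G] := QG K; apply: leq_ltn_trans (P2n x).
by apply: hits_subset => k; apply: subsetC => y [|] /P2G; [left|right].
Qed.

End separators_from_covering_dimension.

(** * Visits of orbit segments to separators *)

Section few_visits.
Context {R : realType} {X : metricType R}.
Variables (T : X -> X) (m d : nat).
Hypothesis compactX : compact [set: X].
Hypothesis contT : continuous T.
Hypothesis zeroT : forall A, zero_dim A -> zero_dim (T @` A).
Hypothesis dimX : rdim d.+1 [set: X].

Definition visits (B : set X) (x : X) : nat :=
  hits (fun j => iter j T @^-1` B) m.+1 x.

Lemma closed_visits B r : closed B -> closed [set x | (r <= visits B x)%N].
Proof.
move=> cB; apply: closed_hits => j; apply: preimage_closed => // x _.
exact: continuous_iter.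
Qed.

Lemma zero_dim_set0 : zero_dim (@set0 X).
Proof. by split; [exact: closed0|]. Qed.

Lemma zero_dim_iter_image j A : zero_dim A -> zero_dim (iter j T @` A).
Proof.
move=> zA; elim: j => [|j IH]; first by rewrite image_id.
suff -> : iter j.+1 T @` A = T @` (iter j T @` A) by exact: zeroT.
by rewrite -image_comp.
Qed.

Lemma rdim_set0 n : rdim n (@set0 X).
Proof.
elim: n => //= n IH; exists (fun=> set0) => [_|C cC C0 _].
  exact: zero_dim_set0.
by apply: rdim_subset IH C0.
Qed.

Lemma rdim_bigcup n K (F : nat -> set X) : (forall j, closed (F j)) ->
  (forall j, (j < K)%N -> rdim n (F j)) -> rdim n (\bigcup_(j in `I_K) F j).
Proof.
move=> cF; elim: K => [|K IH] rF.
  by rewrite II0 bigcup_set0; exact: rdim_set0.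
rewrite IIS bigcup_setU bigcup_set1; apply: rdimU => //.
- by apply: closed_bigcup => // ; exact: finite_II.
- by apply: IH => j jK; apply: rF; exact: ltnW.
- exact: rF.
Qed.

(* The dimension of the set of points whose orbit visits B at least r times is
   at most d - r. *)
Definition few (B : set X) :=
  forall r, (r <= d.+1)%N -> rdim (d.+1 - r) [set x | (r <= visits B x)%N].

Lemma visits_le1 (U : set X) x :
  (forall y k, U y -> (0 < k <= m)%N -> ~ U (iter k T y)) ->
  (visits U x <= 1)%N.
Proof.
move=> Um.
have main (i j : 'I_m.+1) : U (iter i T x) -> U (iter j T x) -> ~ (i < j)%N.
  move=> Ui Uj ij; apply: (Um _ (j - i)%N Ui).
    by rewrite subn_gt0 ij leq_subLR (leq_trans _ (leq_addl _ _)) // -ltnS.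
  by rewrite -iterD subnK // ltnW.
rewrite /visits hitsE; apply/card_le1_eqP => i j.
rewrite !inE /= => Ui Uj; apply: ord_inj.
have [ij|ij|//] := ltngtP (nat_of_ord j) (nat_of_ord i).
- by case: (main _ _ Uj Ui ij).
- by case: (main _ _ Ui Uj ij).
Qed.

Lemma visits0 x : visits set0 x = 0%N.
Proof. by rewrite /visits /hits big1 // => j _; case: asboolP. Qed.

Lemma visits_gt0 B x : (0 < visits B x)%N ->
  exists2 j, (j < m.+1)%N & B (iter j T x).
Proof.
rewrite /visits hitsE card_gt0 => /set0Pn[j]; rewrite inE => /asboolP Bj.
by exists j.
Qed.

Lemma visitsU B L x : (visits (B `|` L) x <= visits B x + visits L x)%N.
Proof.
rewrite /visits /hits -big_split; apply: leq_sum => j _ /=.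
case: asboolP => //; case: asboolP => //; case: asboolP => // nL nB [] //.
Qed.

(* The separator avoids the T^j-images of the zero-dimensional sets that witness
   the dimension of each visit set, so one further visit costs a dimension. *)
Lemma few_add_separator B C U : closed B -> few B -> closed C -> open U ->
  C `<=` U -> (forall y k, U y -> (0 < k <= m)%N -> ~ U (iter k T y)) ->
  exists G G', [/\ open G /\ open G', G `&` G' = set0, C `<=` G, ~` U `<=` G' &
    few (B `|` ~` (G `|` G'))].
Proof.
move=> cB fB cC oU CU Um.
have exZ r : exists Z : nat -> set X, (forall i, zero_dim (Z i)) /\
    ((r <= d)%N -> forall D, closed D -> D `<=` [set x | (r <= visits B x)%N] ->
      (forall i, D `&` Z i = set0) -> rdim (d - r) D).
  have [rd|] := leqP r d; last first.
    by exists (fun=> set0); split => // _; exact: zero_dim_set0.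
  have := fB r (leqW rd); rewrite subSn //= => -[Z zZ ZP].
  by exists Z; split => // _; exact: ZP.
have [Z ZP] := choice exZ.
(* If a separator misses the image of [Z r i] under [iter j T], then the set of points whose j-th
   iterate lies on it misses [Z r i]. *)
pose F n := if @unpickle (nat * nat * nat)%type n is Some (r, j, i)
  then iter j T @` Z r i else set0.
have zF n : zero_dim (F n).
  rewrite /F; case: unpickle => [[[r j] i]|]; last exact: zero_dim_set0.
  by apply: zero_dim_iter_image; have [] := ZP r.
have [|G [G' [[oG oG' GG' CG UG'] FG]]] :=
  zero_dim_separator compactX cC (open_closedC oU) _ zF.
  by apply/seteqP; split=> // x [/CU].
exists G, G'; split => //; set L := ~` (G `|` G').
have cL : closed L by apply/open_closedC/openU.
have LU : L `<=` U.
  by move=> x Lx; apply: contrapT => /UG' G'x; apply: Lx; right.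
have L1 x : (visits L x <= 1)%N.
  by apply: visits_le1 => y k /LU Uy km /LU; exact: Um.
case=> [|r] rd.
  rewrite subn0; exact: rdim_subset dimX _.
pose A r := [set x | (r <= visits B x)%N].
have cA s : closed (A s) by exact: closed_visits.
(* The new separator is visited at most once, so r + 1 visits to the enlarged set mean r + 1 visits
   to B, or r visits to B together with one to L. *)
apply: (@rdim_subset _ _ _ (A r.+1 `|`
    \bigcup_(j in `I_m.+1) (A r `&` iter j T @^-1` L))).
  apply: rdimU => //.
  - apply: closed_bigcup => [|j _]; first exact: finite_II.
    apply: closedI => //; apply: preimage_closed => // x _.
    exact: continuous_iter.
  - exact: fB.
  apply: rdim_bigcup => j.
    by apply: closedI => //; apply: preimage_closed => // x _;
        exact: continuous_iter.
  move=> jm; have [_ /(_ rd)] := ZP r; rewrite subSS; apply.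
  - by apply: closedI => //; apply: preimage_closed => // x _;
      exact: continuous_iter.
  - by move=> x [].
  move=> i; apply/seteqP; split=> // x [[_ Lx] Zx]; apply: Lx.
  by apply: (FG (pickle (r, j, i))); rewrite /F pickleK; exists x.
move=> x /= rx; have [Bx|Bx] := leqP r.+1 (visits B x); first by left.
have h := leq_trans rx (visitsU B L x); right.
have [|j jm Lj] := @visits_gt0 L x.
  by rewrite lt0n; apply/eqP => L0; move: h; rewrite L0 addn0 leqNgt Bx.
exists j => //; split => //=; have := L1 x; rewrite /A /=.
by move: h; lia.
Qed.

Lemma exists_few_visits N (C U : nat -> set X) :
  (forall i, closed (C i)) -> (forall i, open (U i)) ->
  (forall i, C i `<=` U i) ->
  (forall i y k, U i y -> (0 < k <= m)%N -> ~ U i (iter k T y)) ->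
  exists G, [/\ open_pairs G,
    forall i, (i < N)%N -> C i `<=` G i true,
    forall i, (i < N)%N -> ~` U i `<=` G i false &
    forall x, (visits (\bigcup_(i in `I_N) gap G i) x <= d)%N].
Proof.
move=> cC oU CU Um.
have [G [oG CG UG fG]] : exists G, [/\ open_pairs G,
    forall i, (i < N)%N -> C i `<=` G i true,
    forall i, (i < N)%N -> ~` U i `<=` G i false &
    few (\bigcup_(i in `I_N) gap G i)].
  elim: N => [|N [G [[oG dG] CG UG fG]]].
    exists (fun _ _ => set0); split => //.
      by split=> [_ _|_]; [exact: open0|rewrite setI0].
    rewrite II0 bigcup_set0 => -[|r] rd; first by rewrite subn0;
        apply: rdim_subset dimX _.
    apply: rdim_subset (rdim_set0 _) _ => x /=; by rewrite visits0.
  have cB : closed (\bigcup_(i in `I_N) gap G i).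
    apply: closed_bigcup => [|i _]; first exact: finite_II.
    by apply/open_closedC/openU.
  have [G1 [G2 [[oG1 oG2] G12 CG1 UG2 fG1]]] :=
    few_add_separator cB fG (cC N) (oU N) (CU N) (Um N).
  (* Indices above N repeat the newest pair until a later step overwrites them. *)
  pose G3 i b := if (i < N)%N then G i b else if b then G1 else G2.
  exists G3; split.
  - split=> [i b|i]; rewrite /G3; case: ifP => // _; by case: b.
  - move=> i; rewrite ltnS leq_eqVlt /G3 => /orP[/eqP ->|iN].
      by rewrite ltnn.
    by rewrite iN; exact: CG.
  - move=> i; rewrite ltnS leq_eqVlt /G3 => /orP[/eqP ->|iN].
      by rewrite ltnn.
    by rewrite iN; exact: UG.
  rewrite IIS bigcup_setU bigcup_set1 {2}/gap /G3 ltnn.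
  suff -> : \bigcup_(i in `I_N) gap G3 i = \bigcup_(i in `I_N) gap G i by [].
  by apply: eq_bigcupr => i /= iN; rewrite /gap /G3 iN.
exists G; split => // x; rewrite leqNgt; apply/negP => dx.
(* For r = d + 1 the bound is [rdim 0], that is, emptiness. *)
have := fG d.+1 (leqnn _); rewrite subnn /= => h.
have : [set x | (d < visits (\bigcup_(i in `I_N) gap G i) x)%N] x by [].
by rewrite h.
Qed.

End few_visits.

(** * Perturbation of the map and of the observable *)

Section small_pieces.
Context {R : realType} {X : metricType R}.
Variables (T : X -> X) (m d : nat).
Hypothesis compactX : compact [set: X].
Hypothesis contT : continuous T.

(** An iterate outside the closed set B stays outside a small neighbourhood of B when x moves a
    little. Hence the number of visits does not increase near x, and compactness gives one radius
    for all x. *)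
Lemma open_few_visits (B : set X) : closed B ->
  (forall x, (visits T m B x <= d)%N) ->
  exists O, [/\ open O, B `<=` O & forall x, (visits T m O x <= d)%N].
Proof.
move=> cB Bd.
pose O (e : R) := \bigcup_(b in B) interior (ball b e).
have cov : near_covering [set: X] by exact/compact_near_coveringP.
have nearO : \forall e \near 0^'+,
    [set: X] `<=` [set x | (visits T m (O e) x <= d)%N].
  apply: (cov _ (0^'+) (fun e x => (visits T m (O e) x <= d)%N)) => x _.
  have nearj (j : 'I_m.+1) : \forall y \near x & e \near 0^'+,
      O e (iter j T y) -> B (iter j T x).
    have [Bx|nBx] := pselect (B (iter j T x)); first by near=> y e.
    have /nbhs_ballP[r /= r0 rB] := open_nbhs_nbhs (conj (closed_openC cB) nBx).
    have r2 : 0 < r / 2 by rewrite divr_gt0.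
    have /cvg_ballP/(_ _ r2) cTj := @continuous_iter _ T j contT x.
    exists ([set y | ball (iter j T x) (r / 2) (iter j T y)],
        [set e | e < r / 2]).
      by split; [exact: cTj|exact: (nbhs_right_lt r2)].
    move=> [y e] /= [xy er] [b Bb /interior_subset bTy]; exfalso.
    apply: (rB b _ Bb); rewrite [r]splitr; apply: ball_triangle xy _.
    by apply: ball_sym; apply: le_ball bTy; exact: ltW.
  have all_near : filter_prod (nbhs x) 0^'+ [set ye : X * R |
      forall j : 'I_m.+1, O ye.2 (iter j T ye.1) -> B (iter j T x)].
    exact: filter_forall nearj.
  apply: (filterS _ all_near) => -[y e] /= ye.
  apply: leq_trans (Bd x); rewrite /visits !hitsE.
  apply/subset_leq_card/fintype.subsetP => j; rewrite !inE.
  by move=> Oj; exact: ye.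
have [e [e0 eO]] : exists e : R, 0 < e /\
    [set: X] `<=` [set x | (visits T m (O e) x <= d)%N].
  near (0 : R)^'+ => e; exists e; split; first by near: e; exact: nbhs_right_gt.
  by near: e.
exists (O e); split.
- by apply: bigcup_open => b _; exact: open_interior.
- by move=> b Bb; exists b => //; exact: nbhsx_ballx.
- by move=> x; exact: eO.
Unshelve. all: by end_near. Qed.

Lemma wandering_ball (x : X) :
  (forall k, (0 < k <= m)%N -> iter k T x <> x) ->
  exists2 e : R, 0 < e & forall y k, ball x e y -> (0 < k <= m)%N ->
    ~ ball x e (iter k T y).
Proof.
elim: m => [|m' IH] xk.
  by exists 1 => // y [|k].
have [k /andP[k0 km]|e e0 eP] := IH; first by apply: xk; rewrite k0 leqW.
pose r := mdist x (iter m'.+1 T x).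
have r0 : 0 < r / 2.
  rewrite divr_gt0 // mdist_gt0; apply/eqP => h; apply: (xk m'.+1) => //.
  by rewrite ltnSn.
have /cvg_ballP/(_ _ r0)/nbhs_ballP[e' /= e'0 e'P] :=
    @continuous_iter _ T m'.+1 contT x.
exists (Num.min e (Num.min e' (r / 2))); first by rewrite !lt_min e0 e'0.
move=> y k xy /andP[k0]; rewrite leq_eqVlt ltnS => /orP[/eqP ->|km] xTy;
    last first.
  apply: (eP y k); rewrite ?k0 //.
    by apply: le_ball xy; rewrite ge_min lexx.
  by apply: le_ball xTy; rewrite ge_min lexx.
have h1 : ball x (r / 2) (iter m'.+1 T y).
  by apply: le_ball xTy; rewrite !ge_min lexx !orbT.
have h2 : ball x e' y by apply: le_ball xy; rewrite !ge_min lexx !orbT.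
have := ball_triangle h1 (ball_sym (e'P _ h2)).
by rewrite -splitr ballEmdist /= ltxx.
Qed.

Hypothesis zeroT : forall A, zero_dim A -> zero_dim (T @` A).
Hypothesis dimX : rdim d.+1 [set: X].

(** Here D is what remains after removing an open neighbourhood of all separators. Inside D each
    [G i true] is relatively clopen, its complement being that of the open side [G i false]. Points
    of D in none of these sets lie in some [W l], and disjointness of the [W l] makes those
    remaining pieces clopen as well. *)
Lemma small_pieces_complement (good : set X -> Prop) (M : nat) (W : nat ->
    set X) :
  (forall U V, V `<=` U -> good U -> good V) ->
  (forall x, exists2 e : R, 0 < e & good (ball x e)) ->
  (forall l, open (W l)) -> (forall l, (l < M)%N -> good (W l)) ->
  (forall l l' x, (l < M)%N -> (l' < M)%N -> W l x -> W l' x -> l = l') ->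
  (forall x k, (0 < k <= m)%N -> iter k T x = x ->
      exists2 l, (l < M)%N & W l x) ->
  exists D N c, [/\ closed D, clopen_coloring D N c,
    forall x, D x -> good (D `&` c @^-1` [set c x]) &
    forall x, (visits T m (~` D) x <= d)%N].
Proof.
move=> goodS goodx oW gW dW perW.
pose WM := \bigcup_(l in `I_M) W l.
have oWM : open WM by apply: bigcup_open.
have ex x : exists e : R, ~ WM x -> [/\ 0 < e, good (ball x e) &
    forall y k, ball x e y -> (0 < k <= m)%N -> ~ ball x e (iter k T y)].
  have [|nW] := pselect (WM x); first by exists 1.
  have [k km kx|e1 e10 e1P] := @wandering_ball x.
    by apply: nW; have [l lM Wl] := perW x k km kx; exists l.
  have [e2 e20 ge2] := goodx x.
  exists (Num.min e1 e2) => _; split; first by rewrite lt_min e10.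
    by apply: goodS ge2; apply: le_ball; rewrite ge_min lexx orbT.
  have le : ball x (Num.min e1 e2) `<=` ball x e1.
    by apply: le_ball; rewrite ge_min lexx.
  by move=> y k /le xy km /le; exact: e1P.
have [e eP] := choice ex.
have cWM : closed (~` WM) by exact: open_closedC.
have [x nWx|s sW sP] := @compact_finite_subcover X (~` WM)
    (fun x => ball x (e x / 2)) (subclosed_compact cWM compactX (@subsetT _ _)).
  by apply: nbhsx_ballx; have [e0 _ _] := eP x nWx; rewrite divr_gt0.
pose C i : set X := if onth s i is Some x then closure (ball x (e x / 2)) else
    set0.
pose U i : set X := if onth s i is Some x then interior (ball x (e x)) else
    set0.
have eS i x : onth s i = Some x -> [/\ 0 < e x, good (ball x (e x)) &
    forall y k, ball x (e x) y -> (0 < k <= m)%N ->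
        ~ ball x (e x) (iter k T y)].
  by move=> ix; apply/eP/sW/onthP; exists i.
have [||||G [[oG dG] CG UG GB]] := exists_few_visits compactX contT zeroT dimX
    (size s) (C := C) (U := U) (m := m).
- by move=> i; rewrite /C; case: onth => [x|];
    [exact: closed_closure|exact: closed0].
- by move=> i; rewrite /U; case: onth => [x|];
    [exact: open_interior|exact: open0].
- move=> i; rewrite /C /U; case ix: (onth s i) => [x|] //.
  have [e0 _ _] := eS i x ix; have e2 : 0 < e x / 2 by rewrite divr_gt0.
  have := closure_ball_interior (y := x) e2.
  by rewrite [2 * _]mulrC divfK.
- move=> i y k; rewrite /U; case ix: (onth s i) => [x|] //.
  have [_ _ xk] := eS i x ix.
  by move=> /interior_subset xy km /interior_subset; exact: xk.
have cB : closed (\bigcup_(i in `I_(size s)) gap G i).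
  apply: closed_bigcup => [|i _]; first exact: finite_II.
  by apply/open_closedC/openU.
have [V [oV BV Vvis]] := open_few_visits cB GB.
pose D := ~` V; have cD : closed D by exact: open_closedC.
have DG x i : D x -> (i < size s)%N -> ~ G i true x -> G i false x.
  move=> Dx ilt nG; apply: contrapT => nG'; apply: Dx; apply: BV;
      exists i => //.
  by move=> [].
have disj x i : G i true x -> G i false x -> False.
  by move=> h h'; have : (G i true `&` G i false) x by []; rewrite dG.
pose p i := D `&` G i true.
have cp i : (i < size s)%N -> closed (p i).
  move=> ilt; have -> : p i = D `&` ~` G i false.
    apply/seteqP; split=> x [Dx Gx]; split => //;
        first by move=> /(disj _ _ Gx).
    by apply: contrapT => /(DG _ _ Dx ilt).
  by apply: closedI => //; exact: open_closedC.
have cDp i : closed (D `\` p i).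
  have -> : D `\` p i = D `&` ~` G i true.
    by apply/seteqP; split=> x [Dx h]; split => //; [move=> h'; apply: h|case].
  by apply: closedI => //; exact: open_closedC.
pose Q := \bigcup_(i in `I_(size s)) G i true.
have oQ : open Q by apply: bigcup_open.
have DQW x : D x -> ~ Q x -> WM x.
  move=> Dx nQ; apply: contrapT => nW; have [y /onthP[i iy] yx] := sP x nW.
  have ilt : (i < size s)%N by rewrite -onthTE iy.
  apply: nQ; exists i => //; apply: CG => //; rewrite /C iy;
      exact: subset_closure.
pose q l := D `&` ~` Q `&` W l.
have cq l : (l < M)%N -> closed (q l).
  move=> lM; have -> : q l = (D `&` ~` Q) `&`
      ~` \bigcup_(l' in [set l' | (l' < M)%N /\ l' <> l]) W l'.
    apply/seteqP; split=> x [DQx Wx]; split => //.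
      by move=> [l' [l'M ne] Wl']; apply: ne; exact: dW Wl' Wx.
    have [Dx nQ] := DQx; have [l' l'M Wl'] := DQW x Dx nQ.
    have [<- //|ne] := pselect (l' = l); by exfalso; apply: Wx; exists l'.
  apply: closedI; last by apply/open_closedC/bigcup_open.
  by apply: closedI => //; exact: open_closedC.
have cDq l : closed (D `\` q l).
  have -> : D `\` q l = (\bigcup_(i in `I_(size s)) p i) `|` (D `&` ~` W l).
    apply/seteqP; split=> x.
      move=> [Dx nq]; have [Wx|nW] := pselect (W l x); last by right.
      left; have [[i ilt Gx]|nQ] := pselect (Q x); first by exists i.
      by exfalso; apply: nq.
    move=> [[i ilt [Dx Gx]]|[Dx nW]]; split => //; last by move=> [].
    by move=> [[_ nQ] _]; apply: nQ; exists i.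
  apply: closedU; last by apply: closedI => //; exact: open_closedC.
  by apply: closed_bigcup => [|i ilt]; [exact: finite_II|exact: cp].
pose ps := [seq p i | i <- iota 0 (size s)] ++ [seq q l | l <- iota 0 M].
have [|x Dx||col colP] := @clopen_coloring_of_seq X D ps.
- move=> t; rewrite mem_cat => /orP[] /mapP[i];
    rewrite mem_iota add0n => /= ilt ->.
    by split; [exact: cp|exact: cDp].
  by split; [exact: cq|exact: cDq].
- have [[i ilt Gx]|nQ] := pselect (Q x).
    by exists (p i) => //; rewrite mem_cat map_f // mem_iota.
  have [l lM Wl] := DQW x Dx nQ; exists (q l) => //.
  by rewrite mem_cat map_f ?orbT // mem_iota.
- exact: cD.
exists D, (size ps), (fun x => find (fun t : set X => `[< t x >]) ps);
    split => //.
  move=> x Dx; set c := (fun x => _).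
  have sub : D `&` c @^-1` [set c x] `<=` nth set0 ps (c x).
    by move=> y [Dy yx]; have := colP y Dy; rewrite -/(c y) [c y]yx.
  apply: (goodS _ _ sub).
  have : nth set0 ps (c x) \in ps by apply: mem_nth; exact: col.1.
  rewrite {2}/ps mem_cat => /orP[] /mapP[i];
      rewrite mem_iota add0n => /= ilt ->.
    have : p i `<=` U i.
      by move=> y [Dy Gy]; apply: contrapT => /(UG i ilt) /(disj _ _ Gy).
    rewrite /U; case ix: (onth s i) => [z|] pz.
      have [_ gz _] := eS i z ix; apply: (goodS _ _ _ gz) => y /pz;
          exact: interior_subset.
    by move: ilt; rewrite -onthTE ix.
  by apply: (goodS _ _ _ (gW i ilt)) => y [].
by move=> x; rewrite setCK.
Qed.

End small_pieces.

Lemma injective_perturbation {R : realType} (b : nat -> R) (e : R) (N : nat) :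
  0 < e -> exists a : nat -> R, (forall i, (i < N)%N -> `|b i - a i| <= e) /\
    forall i j, (i < N)%N -> (j < N)%N -> a i = a j -> i = j.
Proof.
move=> e0; elim: N => [|N [a [ab ainj]]]; first by exists b.
(* Infinitely many candidates within e of [b N], of which the N earlier values exclude at most N. *)
pose t (k : nat) : R := b N + e / k.+1%:R.
have tinj k k' : t k = t k' -> k = k'.
  move=> /addrI /(mulfI (lt0r_neq0 e0)) /invr_inj /eqP.
  by rewrite eqr_nat eqSS => /eqP.
have [k kP] : exists k, forall i, (i < N)%N -> a i <> t k.
  apply: contrapT => nk.
  have ex k : exists i : 'I_N, a i = t k.
    apply: contrapT => ni; apply: nk; exists k => i iN ik; apply: ni.
    by exists (Ordinal iN).
  have [i iP] := choice ex.
  have /leq_card : injective (fun k : 'I_N.+1 => i k).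
    move=> k k' /= ikk'; apply: ord_inj; apply: tinj.
    by rewrite -!iP ikk'.
  by rewrite !card_ord ltnn.
exists (fun i => if i == N then t k else a i); split=> [i|i j].
  rewrite ltnS leq_eqVlt; case: eqP => [-> _|_ /=]; last exact: ab.
  rewrite /t opprD addNKr normrN ger0_norm; last by rewrite divr_ge0 // ltW.
  by rewrite ler_pdivrMr ?ltr0n // ler_peMr ?ler1n ?ltW.
rewrite !ltnS (leq_eqVlt i) (leq_eqVlt j).
case: eqP => [->|_] /=; case: eqP => [->|_] //= iN jN.
- by move=> /esym /kP; case.
- by move=> /kP; case.
- exact: ainj.
Qed.

Section locally_constant_observables.
Context {R : realType} {X : metricType R}.
Hypothesis compactX : compact [set: X].

Lemma clopen_coloring_near (D : set X) N c (z : set_type D) :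
  clopen_coloring D N c -> nbhs z [set z' | c (val z') = c (val z)].
Proof.
move=> cD; apply: (@filterS _ (nbhs z) _
    (val @^-1` (~` (D `&` c @^-1` [set i | i <> c (val z)])))).
  move=> z' /= h; apply: contrapT => ne; apply: h; split => //.
  exact: set_mem (valP z').
apply: open_nbhs_nbhs; split; last by move=> [_]; apply.
exists (~` (D `&` c @^-1` [set i | i <> c (val z)])) => //.
by apply: closed_openC; exact: closed_color_union cD.
Qed.

Lemma coloring_continuous (D : set X) N c (a : nat -> R) :
  clopen_coloring D N c -> continuous (fun z : set_type D => a (c (val z))).
Proof.
move=> cD z U aU; apply: (filterS _ (clopen_coloring_near z cD)) => z' zz'.
by apply: nbhs_singleton; rewrite zz'.
Qed.

(** On D the new observable is a constant on each piece, within e of the values of [f0] there and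
    moved by at most e more to make the constants distinct. The difference from [f0], bounded by 2e
    on D, extends to X with the same bound by Tietze's theorem. *)
Lemma locally_constant_observable (f0 : continuousType X R) (e : R)
    (D : set X) N c : 0 < e -> closed D -> clopen_coloring D N c ->
  (forall x y, D x -> D y -> c x = c y -> `|f0 x - f0 y| <= e) ->
  exists f : continuousType X R, (forall x, `|f0 x - f x| <= 2 * e) /\
    forall x y, D x -> D y -> f x = f y -> c x = c y.
Proof.
move=> e0 closedD cD osc.
have exb i : exists b, forall x, D x -> c x = i -> `|b - f0 x| <= e.
  have [[y [Dy <-]]|ny] := pselect (exists y, D y /\ c y = i).
    by exists (f0 y) => x Dx xy; exact: osc.
  by exists 0 => x Dx xi; exfalso; apply: ny; exists x.
have [b bP] := choice exb.
have [a [ab ainj]] := injective_perturbation b N e0.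
pose g (x : X) : R^o := a (c x) - f0 x.
have gc : {within D, continuous g}.
  apply/subspace_sigL_continuousP.
  have fc : continuous (fun z : set_type D => f0 (val z)).
    move=> z; apply: (@continuous_comp _ _ _ (val : set_type D -> X) f0).
      exact: initial_continuous.
    exact: cts_fun.
  have ac := coloring_continuous (a := a) cD.
  exact: (fun z => cvgB (ac z) (fc z)).
have e2 : 0 < 2 * e by rewrite mulr_gt0.
have gb x : D x -> `|g x| <= 2 * e.
  move=> Dx; have := ab (c x) (cD.1 x Dx); have := bP (c x) x Dx erefl.
  rewrite /g !ler_norml => /andP[h1 h2] /andP[h3 h4].
  by apply/andP; split; lra.
have [h [gh hc hb]] :=
  continuous_bounded_extension (normalX compactX) closedD e2 gc gb.
have fc : continuous (fun x => f0 x + h x).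
  by move=> x; apply: (@cvgD _ R^o); [exact: cts_fun|exact: hc].
exists (mkcts fc); split.
  by move=> x; rewrite /= /mkcts opprD addNKr normrN; exact: hb.
have fE x : D x -> f0 x + h x = a (c x).
  by move=> Dx; rewrite -gh ?inE // /g addrC subrK.
move=> x y Dx Dy; rewrite /= /mkcts !fE // => axy.
by apply: ainj axy; exact: cD.1.
Qed.

End locally_constant_observables.

Section choice_of_the_map.
Context {R : realType} {X : metricType R}.
Hypothesis dcrX : zero_DCR X.
Variable good : set X -> Prop.
Hypothesis goodS : forall U V, V `<=` U -> good U -> good V.
Hypothesis goodx : forall x, exists2 e : R, 0 < e & good (ball x e).
Variable m : nat.

Let compactX : compact [set: X]. Proof. by have [] := dcrX. Qed.

Lemma dense_near (E : set (continuousType X X)) (T : continuousType X X)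
    (A : set (continuousType X X)) :
  dense E -> nbhs T A -> exists2 T', E T' & A T'.
Proof.
move=> dE nA; have [|T' [AT' ET']] := dE (interior A) _ (@open_interior _ _).
  by exists T.
by exists T' => //; exact: interior_subset AT'.
Qed.

Definition periodic (T : X -> X) : set X :=
  [set x | exists2 k, (0 < k <= m)%N & iter k T x = x].

Lemma periodic_chain_recurrent T : periodic T `<=` chain_recurrent T.
Proof.
move=> x [k /andP[k0 _] kx] e e0; exists k, (fun i => iter i T x).
by split => // i _; rewrite /= mdistxx.
Qed.

Lemma closed_fixed (h : X -> X) : continuous h -> closed [set x | h x = x].
Proof.
move=> ch; have -> : [set x | h x = x] = ~` [set x | h x != x].
  by apply/seteqP; split=> x /=; [move=> -> /eqP|move=> /negP/negPn/eqP].
apply: open_closedC; rewrite openE => x /= hx.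
pose e := mdist (h x) x / 2; have e0 : 0 < e by rewrite divr_gt0 // mdist_gt0.
have /cvg_ballP/(_ _ e0) hnear := ch x.
apply: filterS (filterI hnear (nbhsx_ballx x _ e0)) => y [/= h1 h2].
apply/eqP => hy; rewrite hy in h1.
by have := ball_triangle h1 (ball_sym h2); rewrite -splitr ballEmdist /= ltxx.
Qed.

Lemma closed_periodic (T : continuousType X X) : closed (periodic T).
Proof.
have -> : periodic T =
    \bigcup_(k in [set k | (0 < k <= m)%N]) [set x | iter k T x = x].
  by apply/seteqP; split=> x [k km kx]; exists k.
apply: closed_bigcup => [|k _].
  by apply: sub_finite_set (finite_II m.+1) => k /andP[].
by apply: closed_fixed; apply: continuous_iter; exact: cts_fun.
Qed.

(** Each class of a fine coloring of P is fattened against the union of the other classes. Removing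
    the other fattened classes from its interior makes the neighbourhoods disjoint and keeps every
    point of the class, which lies on the false side of the others. *)
Lemma disjoint_good_cover (P : set X) : zero_dim P ->
  exists M (W : nat -> set X), [/\ forall l, open (W l),
    forall l, (l < M)%N -> good (W l),
    forall l l' x, (l < M)%N -> (l' < M)%N -> W l x -> W l' x -> l = l' &
    forall x, P x -> exists2 l, (l < M)%N & W l x].
Proof.
move=> zP.
have [x Px|U V VU [B [oB UB gB]]|M [c [cM goodc]]] := zero_dim_coloring compactX
    (good := fun A => exists U, [/\ open U, A `<=` U & good U]) zP.
- have [e e0 ge] := goodx x; exists (interior (ball x e)); split.
  + exact: open_interior.
  + exact: nbhsx_ballx.
  exists (interior (ball x e)); split => //; first exact: open_interior.
  exact: goodS (@interior_subset _ _) ge.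
- by exists B; split => //; exact: subset_trans VU UB.
have exU l : exists U, (l < M)%N ->
    [/\ open U, P `&` c @^-1` [set l] `<=` U & good U].
  by have [lM|] := ltnP l M; [have [U] := goodc l lM; exists U|exists set0].
have [U UP] := choice exU.
have [|F [[cF dF] PF]] := fatten_pairs compactX (P := fun l b =>
    P `&` c @^-1` (if b then [set l] else [set i | i <> l])).
  split=> [l b|l]; first exact: closed_color_union cM.
  by apply/seteqP; split=> // x [[_ xl] [_]]; apply.
pose W l := (if (l < M)%N then U l else set0) `&` interior (F l true) `&`
  ~` \bigcup_(l' in [set l' | (l' < M)%N /\ l' <> l]) F l' true.
exists M, W; split.
- move=> l; apply: openI; first apply: openI; last 1 first.
  + apply/closed_openC/closed_bigcup => //.
    by apply: sub_finite_set (finite_II M) => l' [].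
  + by case: ifP => [lM|_]; [have [] := UP l lM|exact: open0].
  exact: open_interior.
- move=> l lM; have [_ _ gU] := UP l lM; apply: (goodS _ gU) => x [[]].
  by rewrite lM.
- move=> l l' x lM l'M [[_ xl] nl] [_ nl']; apply: contrapT => ne; apply: nl'.
  by exists l => //; exact: interior_subset xl.
- move=> x Px; have xM := cM.1 x Px; exists (c x) => //; split; first split.
  + by rewrite xM; have [_ sub _] := UP _ xM; apply: sub.
  + by apply: (PF (c x) true x); split.
  move=> [l' [l'M ne] F'x].
  have : interior (F l' false) x by apply: PF; split => //= h; apply: ne.
  move=> /interior_subset Fx.
  by have : (F l' true `&` F l' false) x by []; rewrite dF.
Qed.

(** For each of the finitely many j from 1 to m, having [iter j T x] different from x is an open
    condition on T and x jointly; compactness makes it uniform in x outside W. *)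
Lemma periodic_near (T : continuousType X X) (W : set X) :
  open W -> periodic T `<=` W ->
  nbhs T [set T' : continuousType X X | periodic T' `<=` W].
Proof.
move=> oW PW.
have cov : near_covering [set: X] by exact/compact_near_coveringP.
have : nbhs T [set T' : continuousType X X |
    [set: X] `<=` [set x | periodic T' x -> W x]].
  apply: (cov _ (nbhs T) (fun (T' : continuousType X X) x => periodic T' x ->
      W x)) => x _.
  have [Wx|nWx] := pselect (W x).
    exists (W, setT); first by split => /=;
        [exact: open_nbhs_nbhs|exact: filterT].
    by move=> [y T'] [].
  have nearj (j : 'I_m.+1) : filter_prod (nbhs x) (nbhs T)
      [set yT : X * continuousType X X | (0 < j)%N -> iter j yT.2 yT.1 <> yT.1].
    have [j0|j0] := posnP j; first by apply: filterE => yT; rewrite j0.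
    have Tx : iter j T x <> x.
      by move=> jx; apply: nWx; apply: PW; exists j => //; rewrite j0 /= -ltnS.
    pose e := mdist (iter j T x) x / 2.
    have e0 : 0 < e by rewrite divr_gt0 // mdist_gt0; apply/eqP.
    have /cvg_ballP/(_ _ e0)[[B A] /= [nB nA] BA] :=
        @iterate_continuous R X j (T, x).
    exists (A `&` ball x e, B).
      by split => //=; apply: filterI => //; exact: nbhsx_ballx.
    move=> [y T'] [/= [Ay xy] BT'] _ Ty.
    have := BA (T', y) (conj BT' Ay); rewrite /= Ty => h1.
    by have := ball_triangle h1 (ball_sym xy);
        rewrite -splitr ballEmdist /= ltxx.
  have all_near : filter_prod (nbhs x) (nbhs T) [set yT : X * continuousType X X
      |
      forall j : 'I_m.+1, (0 < j)%N -> iter j yT.2 yT.1 <> yT.1].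
    exact: filter_forall nearj.
  apply: (filterS _ all_near) => -[y T'] /= yT [k /andP[k0 km] ky].
  have km' : (k < m.+1)%N by [].
  by case: (yT (Ordinal km')).
by apply: filterS => T' sub x; apply: sub.
Qed.

Lemma exists_small_periodic_map (T0 : continuousType X X) (e : R) : 0 < e ->
  exists (T : continuousType X X) M (W : nat -> set X),
  [/\ forall x, ball (T0 x) e (T x), doubly_zero_dim T,
      [/\ forall l, open (W l), forall l, (l < M)%N -> good (W l) &
        forall l l' x, (l < M)%N -> (l' < M)%N -> W l x -> W l' x -> l = l'] &
      forall x k, (0 < k <= m)%N -> iter k T x = x ->
          exists2 l, (l < M)%N & W l x].
Proof.
move=> e0; have e2 : 0 < e / 2 by rewrite divr_gt0.
have [_ dD dCR] := dcrX.
have near_ball (T : continuousType X X) :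
    nbhs T [set T' : continuousType X X | forall x, ball (T x) (e / 2) (T' x)].
  by apply/nbhs_continuousTypeP; exists (e / 2).
have [T1 [dim1 _] T01] := dense_near dCR (near_ball T0).
have zP := dim_zero_dim dim1 (@closed_periodic T1)
  (@periodic_chain_recurrent T1).
have [M [W [oW gW dW PW]]] := disjoint_good_cover zP.
have oWM : open (\bigcup_(l in `I_M) W l) by exact: bigcup_open.
have [|T dT [T1T PT]] := dense_near dD
    (filterI (near_ball T1) (@periodic_near T1 _ oWM _)).
  by move=> x /PW[l lM Wl]; exists l.
exists T, M, W; split => // [x|x k km kx].
  by rewrite [e]splitr; exact: ball_triangle (T01 x) (T1T x).
by have [|l lM Wl] := PT x; [exists k|exists l].
Qed.

End choice_of_the_map.

(** * Density of alpha trajectory-embeddings, and the theorem *)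

Lemma hits_count (X : topologicalType) (L : nat -> set X) K x :
  hits L K x = count (fun i => `[< L i x >]) (iota 0 K).
Proof.
rewrite /hits -sum1_count [RHS]big_mkcond /index_iota subn0.
by apply: eq_bigr => i _; case: asbool.
Qed.

Lemma finite_set_upper_bound (S : set nat) : finite_set S ->
  exists m, forall j, S j -> (j <= m)%N.
Proof.
move=> /finite_seqP[s ->]; exists (\max_(i <- s) i) => j /= js.
exact: (@leq_bigmax_seq _ s xpredT id).
Qed.

Section density.
Context {R : realType} {X : metricType R}.
Variable d : nat.
Hypothesis dimX : dim_le X d.
Hypothesis dcrX : zero_DCR X.

Let compactX : compact [set: X]. Proof. by have [] := dcrX. Qed.

Lemma coincidences_few_visits (T : X -> X) (B : set X) (S : set nat) m x y :
  S #= `I_(2 * d + 1) -> (forall j, S j -> (j <= m)%N) ->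
  (forall z, (visits T m B z <= d)%N) ->
  exists2 j, S j & ~ B (iter j T x) /\ ~ B (iter j T y).
Proof.
move=> Sd Sm Bd; apply: contrapT => nS.
have fS : finite_set S by apply/finite_setP; exists (2 * d + 1)%N.
pose s := finmap.enum_fset (fset_set S).
have sS j : (j \in s) = (j \in S) by exact: in_fset_set.
have sz : size s = (2 * d + 1)%N by exact: card_fset_set.
pose a z j := `[< B (iter j T z) >].
have : (size s <= size [seq j <- iota 0 m.+1 | a x j || a y j])%N.
  apply: uniq_leq_size; first exact: finmap.fset_uniq.
  move=> j; rewrite sS => /set_mem Sj.
  rewrite mem_filter mem_iota add0n ltnS Sm // leq0n !andbT.
  apply/orP; apply: contrapT => nab; apply: nS; exists j => //.
  by split=> Bj; apply: nab; [left|right]; apply/asboolP.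
rewrite size_filter sz => h.
have few z : (count (a z) (iota 0 m.+1) <= d)%N.
  by have := Bd z; rewrite /visits hits_count.
have union : (count (fun j => a x j || a y j) (iota 0 m.+1) <=
    count (a x) (iota 0 m.+1) + count (a y) (iota 0 m.+1))%N.
  by rewrite -count_predUI leq_addr.
have := leq_trans h (leq_trans union (leq_add (few x) (few y))); lia.
Qed.

Lemma alpha_trajectory_embedding_dense (alpha : R) (S : set nat) :
  0 < alpha -> S #= `I_(2 * d + 1) ->
  dense [set p : continuousType X X * continuousType X R |
    alpha_trajectory_embedding alpha S p.1 p.2].
Proof.
move=> alpha0 Sd W [[T0 f0] Wp] oW.
have [e e0 eW] := proj1 (nbhs_pairP _ _) (open_nbhs_nbhs (conj oW Wp)).
have e4 : 0 < e / 4 by rewrite divr_gt0.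
have fS : finite_set S by apply/finite_setP; exists (2 * d + 1)%N.
have [m Sm] := finite_set_upper_bound fS.
(* Two kinds of smallness: points of one piece are closer than alpha, and [f0] varies so little that
   an observable constant on pieces is near it. The bound e/4 leads to a change of [f0] by at most
   e/2. *)
pose good (U : set X) := forall x y, U x -> U y ->
  mdist x y < alpha /\ `|f0 x - f0 y| <= e / 4.
have goodS U V : V `<=` U -> good U -> good V.
  by move=> VU gU x y /VU Ux /VU Uy; exact: (gU x y Ux Uy).
have goodx x : exists2 r : R, 0 < r & good (ball x r).
  have e8 : 0 < e / 4 / 2 by rewrite divr_gt0.
  have /cvg_ballP/(_ _ e8)/nbhs_ballP[r /= r0 rP] := @cts_fun _ _ f0 x.
  have a2 : 0 < alpha / 2 by rewrite divr_gt0.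
  exists (Num.min (alpha / 2) r); first by rewrite lt_min a2.
  move=> y z xy xz; split.
    have xy' : ball x (alpha / 2) y by apply: le_ball xy; rewrite ge_min lexx.
    have xz' : ball x (alpha / 2) z by apply: le_ball xz; rewrite ge_min lexx.
    by have := ball_triangle (ball_sym xy') xz'; rewrite -splitr ballEmdist.
  have fy : ball (f0 x) (e / 4 / 2) (f0 y).
    by apply: rP; apply: le_ball xy; rewrite ge_min lexx orbT.
  have fz : ball (f0 x) (e / 4 / 2) (f0 z).
    by apply: rP; apply: le_ball xz; rewrite ge_min lexx orbT.
  have := ball_triangle (ball_sym fy) fz.
  by rewrite -splitr -ball_normE => /ltW.
have [T [M [V [T0T dT [oV gV dV] perV]]]] :=
  exists_small_periodic_map dcrX goodS goodx m T0 e0.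
have contT : continuous T by exact: cts_fun.
have zeroT A : zero_dim A -> zero_dim (T @` A) by exact: zero_dim_image.
have [D [N [c [cD colD gD visD]]]] := small_pieces_complement compactX contT
  zeroT (rdim_dim_lt compactX dimX) goodS goodx oV gV dV perV.
have [|f [f0f fc]] := locally_constant_observable compactX (f0 :=
    f0) e4 cD colD.
  by move=> x y Dx Dy xy; have [] :=
      gD x Dx x y (conj Dx erefl) (conj Dy (esym xy)).
exists (T, f); split.
  apply: eW; split => //= x; rewrite -ball_normE /=.
  by apply: le_lt_trans (f0f x) _; lra.
move=> x y xy fxy.
have [j Sj [/contrapT Dx /contrapT Dy]] :=
    coincidences_few_visits x y Sd Sm visD.
have fj : f (iter j T x) = f (iter j T y).
  exact: (congr1 (fun h => h (exist _ j (mem_set Sj))) fxy).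
(* Equal observations at a time when both iterates are in D put them into one piece, hence at
   distance less than alpha. *)
have cj := fc _ _ Dx Dy fj.
have [] := gD _ Dx (iter j T x) (iter j T y) (conj Dx erefl) (conj Dy (esym
    cj)).
by rewrite ltNge xy.
Qed.

End density.

Theorem theorem5p4 (R : realType) (X : metricType R) (d : nat)
    (compactX : compact [set: X]) (dimX : dim_eq X d) (dcrX : zero_DCR X) :
  [/\ (forall (alpha : R) (S : set nat), 0 < alpha -> S #= `I_(2 * d + 1) ->
         let E := [set p : continuousType X X * continuousType X R |
                     alpha_trajectory_embedding alpha S p.1 p.2] in
         dense E /\ open E),
      (exists E : set (continuousType X X * continuousType X R),
         generic_embedding_set d E),
      (forall E : set (continuousType X X * continuousType X R),
         generic_embedding_set d E ->
         forall (T : continuousType X X) (f : continuousType X R), E (T, f) ->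
         [/\ induces_trajectory_bijection T f,
             preserves_entropy T f &
             forall x y : X, trajectory_separated T x y ->
               [set i : nat | delay_map T f x i = delay_map T f y i]
                 #<= `I_(2 * d)]) &
      reconstruction_space X].
Proof.
have [dimd _] := dimX.
have dE := @alpha_trajectory_embedding_dense R X d dimd dcrX.
have part3 (E : set (continuousType X X * continuousType X R)) :
    generic_embedding_set d E ->
    forall (T : continuousType X X) (f : continuousType X R), E (T, f) ->
    [/\ induces_trajectory_bijection T f, preserves_entropy T f &
      forall x y : X, trajectory_separated T x y ->
        [set i : nat | delay_map T f x i = delay_map T f y i] #<= `I_(2 * d)].
  move=> [_ _ embE] T f TfE; have emb := embE T f TfE; split.
  - exact: delay_induces_bijection emb.
  - apply: (@delay_preserves_entropy _ _ (2 * d)) => //.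
    exact: delay_map_eq_iter emb.
  - exact: card_coincidences_le emb.
have part2 := exists_generic_embedding_set compactX dE.
split => // [alpha S alpha0 Sd E|].
  by split; [exact: dE|exact: alpha_trajectory_embedding_open].
split => //; have [E genE] := part2; exists E.
have [GE denseE _] := genE; split => // T f TfE.
by have [] := part3 E genE T f TfE.
Qed.
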